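(* Let $(u^\epsilon,m^\epsilon)$ be a solution of the regularized mean-field game system described in the context, under the standing assumptions (1)--(7) stated there. Let $a,b>1$ be such that $$\frac d2<\frac{b(a-1)}{a}.$$ Then there exists $C>0$ such that $$\|u^\epsilon\|_{L^\infty(0,T;L^\infty(\mathbb{T}^d))}\le C+C\|g_\epsilon(m^\epsilon)\|_{L^a(0,T;L^b(\mathbb{T}^d))}.$$
   Context: $\mathbb{T}^d$ is the $d$-dimensional flat torus, $T>0$ fixed, $D=D_x$ the spatial gradient. For $\epsilon>0$, $\eta_\epsilon$ is a standard symmetric mollifying kernel and $g_\epsilon(m)=\eta_\epsilon*g(\eta_\epsilon*m)$. A solution $(u^\epsilon,m^\epsilon)$ is a classical (smooth) solution on $\mathbb{T}^d\times[0,T]$ of $$-u^\epsilon_t+H(x,Du^\epsilon)=\Delta u^\epsilon+g_\epsilon(m^\epsilon),\qquad m^\epsilon_t-\operatorname{div}(D_pH(x,Du^\epsilon)m^\epsilon)=\Delta m^\epsilon,$$ with $u^\epsilon(x,T)=u_0(x)$, $m^\epsilon(x,0)=m_0(x)$. The constant $C$ depends only on $d,T,H,g,u_0,m_0,a,b$ and not on $\epsilon$. Standing assumptions: (1) $H:\mathbb{T}^d\times\mathbb{R}^d\to\mathbb{R}$, $d>2$, is smooth; $p\mapsto H(x,p)$ is strictly convex for each $x$; $\lim_{|p|\to\infty}H(x,p)/|p|=+\infty$; $H\ge 1$. Moreover $u_0,m_0\in C^\infty(\mathbb{T}^d)$, $m_0\ge0$, $\int_{\mathbb{T}^d}m_0=1$.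 (2) $g:[0,\infty)\to\mathbb{R}$ is non-negative and increasing. (3) With $\hat L(x,p)=D_pH(x,p)\cdot p-H(x,p)$, there are $c,C>0$ with $\hat L(x,p)\ge cH(x,p)-C$. (4) $g(m)=m^\alpha$ for some $\alpha>0$. (5) $|D_xH|,|D^2_{xx}H|\le CH+C$, and for every $\delta>0$ there is $C_\delta$ such that $\operatorname{Tr}(D^2_{px}H\,M)\le\delta\operatorname{Tr}(D^2_{pp}H\,M^2)+C_\delta H$ for every symmetric matrix $M$. (6) $m_0\ge\kappa_0$ for some $\kappa_0>0$. (7) $H(x,p)\le C|p|^\gamma+C$ for some $1+\frac1{d+1}<\gamma<2$. *)

(* Defs.v *)
From HB Require Import structures.
From mathcomp Require Import all_boot all_order all_algebra.
From mathcomp Require Import all_classical all_reals all_analysis.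

Set Implicit Arguments.
Unset Strict Implicit.
Unset Printing Implicit Defensive.

Import Order.TTheory GRing.Theory Num.Theory.
Import numFieldNormedType.Exports.

Local Open Scope classical_set_scope.
Local Open Scope ring_scope.

(* Functions on the flat torus T^d = R^d / Z^d are Z^d-periodic functions on
   'rV[R]_d; integrals over T^d are taken over the cell [0,1[^d. *)

Section calculus.
Context {R : realType}.

(* 'D_v f x has a junk value when f is not derivable, hence the explicit
   derivability clause. *)
Fixpoint Ck {V : normedModType R} (k : nat) (f : V -> R) : Prop :=
  if k is k'.+1 then
    continuous f /\
    forall v : V, (forall x, derivable f x v) /\ Ck k' (fun x => 'D_v f x)
  else continuous f.

Definition smooth {V : normedModType R} (f : V -> R) : Prop :=
  forall k : nat, Ck k f.

Context {d : nat}.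
Implicit Types (f : 'rV[R]_d -> R) (F : 'rV[R]_d -> 'rV[R]_d) (x p : 'rV[R]_d).

Definition unitv (i : 'I_d) : 'rV[R]_d := delta_mx 0 i.

Definition partial (i : 'I_d) f x : R := 'D_(unitv i) f x.

Definition grad f x : 'rV[R]_d := \row_i partial i f x.

Definition divergence F x : R := \sum_i partial i (fun y => F y 0 i) x.

Definition laplacian f x : R := \sum_i partial i (partial i f) x.

Definition dot x p : R := \sum_i x 0 i * p 0 i.

(* The library norm on matrices is the sup norm; the next two are the
   Euclidean and the Frobenius norm. *)
Definition enorm x : R := Num.sqrt (dot x x).

Definition frobenius (M : 'M[R]_d) : R :=
  Num.sqrt (\sum_i \sum_j M i j ^+ 2).

Definition torus_periodic {W : Type} (f : 'rV[R]_d -> W) : Prop :=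
  forall (i : 'I_d) x, f (x + unitv i) = f x.

(* Smooth up to the boundary of T^d x [0,T], i.e. the restriction of a smooth
   function; nothing is required of the values of f outside [0,T]. *)
Definition smooth_on_cylinder (T : R) (f : 'rV[R]_d -> R -> R) : Prop :=
  (exists2 F : 'rV[R]_d * R -> R, smooth F &
     forall x (t : R), 0 <= t <= T -> F (x, t) = f x t) /\
  (forall t : R, 0 <= t <= T -> torus_periodic (fun x => f x t)).

End calculus.

Section product_power.
Local Open Scope ereal_scope.
Context {disp : measure_display} {T : measurableType disp} {R : realType}.

Definition tuple_cons (n : nat) (z : T * n.-tuple T) : n.+1.-tuple T :=
  [the n.+1.-tuple T of z.1 :: z.2].

Lemma measurable_tuple_cons n :
  measurable_fun [set: T * n.-tuple T] (@tuple_cons n).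
Proof. exact: measurable_cons. Qed.

Let tuple_uncons (n : nat) (x : n.+1.-tuple T) : T * n.-tuple T :=
  (thead x, [tuple of behead x]).

Let measurable_tuple_uncons n :
  measurable_fun [set: n.+1.-tuple T] (@tuple_uncons n).
Proof.
apply/measurable_fun_pairP; split.
  exact: (@measurable_tnth _ T n.+1 ord0).
exact: measurable_behead.
Qed.

Let tuple_consK n : cancel (@tuple_cons n) (@tuple_uncons n).
Proof. by move=> [x y]; congr pair; apply: val_inj. Qed.

Section step.
Variables (mu : {sigma_finite_measure set T -> \bar R}) (n : nat).
Variable nu : {sigma_finite_measure set (n.-tuple T) -> \bar R}.

Definition power_step : set (n.+1.-tuple T) -> \bar R :=
  pushforward (mu \x nu) (@tuple_cons n).

HB.instance Definition _ := Measure.copy power_step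
  (measure_function_pushforward__canonical__measure_function_Measure
    (mu \x nu) (@measurable_tuple_cons n)).

Let power_step_sigma_finite : sigma_finite setT power_step.
Proof.
have /sigma_finiteP[F [TF ndF Foo]] := sigma_finiteT mu.
have /sigma_finiteP[G [TG ndG Goo]] := sigma_finiteT nu.
exists (fun k => @tuple_uncons n @^-1` (F k `*` G k)).
  apply/esym; rewrite -subTset => x _.
  have [k _ Fk] : (\bigcup_k F k) (thead x) by rewrite -TF.
  have [l _ Gl] : (\bigcup_k G k) [tuple of behead x] by rewrite -TG.
  exists (maxn k l) => //; split => /=.
    by move: Fk; exact/subsetPset/ndF/leq_maxl.
  by move: Gl; exact/subsetPset/ndG/leq_maxr.
move=> k; have [mF Fk] := Foo k; have [mG Gk] := Goo k; split.
  rewrite -[X in measurable X]setTI.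
  by apply: measurable_tuple_uncons => //; exact: measurableX.
rewrite /= /power_step /pushforward -comp_preimage.
rewrite (_ : @tuple_uncons n \o _ = id) ?preimage_id//.
  by rewrite product_measure1E// lte_mul_pinfty// ge0_fin_numE.
by apply/funext => z /=; exact: tuple_consK.
Qed.

HB.instance Definition _ := Measure_isSigmaFinite.Build _ _ _ power_step
  power_step_sigma_finite.

End step.

Fixpoint power_measure (mu : {sigma_finite_measure set T -> \bar R}) (n : nat) :
    {sigma_finite_measure set (n.-tuple T) -> \bar R} :=
  if n is n'.+1 then power_step mu (power_measure mu n')
  else dirac [tuple].

End product_power.

Section torus_integration.
Context {R : realType} {d : nat}.

Definition leb : {sigma_finite_measure set (measurableTypeR R) -> \bar R} :=
  @lebesgue_measure R.

Definition lebd :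
    {sigma_finite_measure set (d.-tuple (measurableTypeR R)) -> \bar R} :=
  power_measure leb d.

Definition row_of (y : d.-tuple (measurableTypeR R)) : 'rV[R]_d :=
  \row_i (tnth y i : R).

Definition cell : set (d.-tuple (measurableTypeR R)) :=
  [set y | forall i, 0 <= row_of y 0 i < 1].

Definition torus_integral (f : 'rV[R]_d -> R) : R :=
  Rintegral lebd cell (fun y => f (row_of y)).

Local Open Scope ereal_scope.

(* Norms over a subset are norms of the extension by zero, [f \_ D]. *)
Definition torus_norm (q : \bar R) (f : 'rV[R]_d -> R) : \bar R :=
  'N[lebd]_q[(fun y => (f (row_of y))%:E) \_ cell].

(* L^p(0,T; L^q(T^d)) *)
Definition mixed_norm (T : R) (p q : \bar R) (f : 'rV[R]_d -> R -> R) : \bar R :=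
  'N[leb]_p[(fun t : R => torus_norm q (fun x => f x t)) \_ `]0%R, T[%classic].

End torus_integration.

Section mean_field_game.
Context {R : realType} {d : nat}.
Implicit Types (H : 'rV[R]_d -> 'rV[R]_d -> R) (g : R -> R).
Implicit Types (eta : 'rV[R]_d -> R) (x p q : 'rV[R]_d).

Definition DxH H x p : 'rV[R]_d := grad (fun y => H y p) x.

Definition DpH H x p : 'rV[R]_d := grad (H x) p.

Definition D2xxH H x p : 'M[R]_d :=
  \matrix_(i, j) partial i (partial j (fun y => H y p)) x.

Definition D2ppH H x p : 'M[R]_d :=
  \matrix_(i, j) partial i (partial j (H x)) p.

Definition D2pxH H x p : 'M[R]_d :=
  \matrix_(i, j) partial i (fun q => partial j (fun y => H y q) x) p.

Definition Lhat H x p : R := dot (DpH H x p) p - H x p.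

Record hamiltonian H : Prop := {
  ham_periodic : torus_periodic H;
  ham_smooth : smooth (fun z : 'rV[R]_d * 'rV[R]_d => H z.1 z.2);
  ham_strictly_convex : forall x p q (s : R), p != q -> 0 < s < 1 ->
    H x (s *: p + (1 - s) *: q) < s * H x p + (1 - s) * H x q;
  ham_superlinear : forall x (A : R), exists r : R,
    forall p, r < enorm p -> A < H x p / enorm p;
  ham_ge1 : forall x p, 1 <= H x p
}.

Record torus_density (m0 : 'rV[R]_d -> R) : Prop := {
  density_periodic : torus_periodic m0;
  density_smooth : smooth m0;
  density_ge0 : forall x, 0 <= m0 x;
  density_mass : torus_integral m0 = 1
}.

(* g : [0,+oo) -> R is represented by a total function whose values on negative
   numbers are unconstrained. *)
Record standing_assumptions H g (u0 m0 : 'rV[R]_d -> R) : Prop := {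
  sa_dim : (2 < d)%N;
  sa_hamiltonian : hamiltonian H;
  sa_u0 : torus_periodic u0 /\ smooth u0;
  sa_m0 : torus_density m0;
  sa_g : (forall s : R, 0 <= s -> 0 <= g s) /\
         (forall s t : R, 0 <= s -> s < t -> g s < g t);
  sa_Lhat : exists c C : R, [/\ 0 < c, 0 < C &
    forall x p, c * H x p - C <= Lhat H x p];
  sa_power : exists2 alpha : R, 0 < alpha &
    forall s : R, 0 <= s -> g s = s `^ alpha;
  sa_DxH : exists C : R, forall x p,
    enorm (DxH H x p) <= C * H x p + C /\
    frobenius (D2xxH H x p) <= C * H x p + C;
  sa_D2pxH : forall delta : R, 0 < delta -> exists Cdelta : R,
    forall x p (M : 'M[R]_d), M^T = M ->
      \tr (D2pxH H x p *m M)
        <= delta * \tr (D2ppH H x p *m (M *m M)) + Cdelta * H x p;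
  sa_m0_pos : exists2 kappa0 : R, 0 < kappa0 & forall x, kappa0 <= m0 x;
  sa_growth : exists gamma C : R, 1 + (d.+1%:R)^-1 < gamma < 2 /\
    forall x p, H x p <= C * enorm p `^ gamma + C
}.

Record mollifying_kernel eta : Prop := {
  kernel_smooth : smooth eta;
  kernel_ge0 : forall y, 0 <= eta y;
  kernel_support : forall y, 1 < enorm y -> eta y = 0;
  kernel_symmetric : forall y, eta (- y) = eta y;
  kernel_mass : Rintegral lebd setT (fun y => eta (row_of y)) = 1
}.

Definition rescale eta (eps : R) (y : 'rV[R]_d) : R :=
  eps ^- d * eta (eps^-1 *: y).

(* For periodic f, the convolution on R^d with a compactly supported kernel is
   the convolution on the torus with the periodized kernel. *)
Definition mollify eta (eps : R) (f : 'rV[R]_d -> R) x : R :=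
  Rintegral lebd setT (fun y => rescale eta eps (row_of y) * f (x - row_of y)).

Definition g_reg g eta (eps : R) (m : 'rV[R]_d -> R -> R) x (t : R) : R :=
  mollify eta eps (fun y => g (mollify eta eps (fun z => m z t) y)) x.

(* sol_domain says that g is only evaluated on its domain [0,+oo). The equations
   are stated on the open interval ]0,T[, where the time derivatives are
   two-sided; they extend to [0,T] by smoothness. *)
Record mfg_solution (T : R) H g (u0 m0 : 'rV[R]_d -> R) eta (eps : R)
    (u m : 'rV[R]_d -> R -> R) : Prop := {
  sol_u_smooth : smooth_on_cylinder T u;
  sol_m_smooth : smooth_on_cylinder T m;
  sol_domain : forall x (t : R), 0 <= t <= T -> 0 <= mollify eta eps (fun z => m z t) x;
  sol_hamilton_jacobi : forall x (t : R), 0 < t < T ->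
    - derive1 (u x) t + H x (grad (fun y => u y t) x)
      = laplacian (fun y => u y t) x + g_reg g eta eps m x t;
  sol_fokker_planck : forall x (t : R), 0 < t < T ->
    derive1 (m x) t
      - divergence (fun y => m y t *: DpH H y (grad (fun z => u z t) y)) x
      = laplacian (fun y => m y t) x;
  sol_terminal : forall x, u x T = u0 x;
  sol_initial : forall x, m x 0 = m0 x
}.

End mean_field_game.

(* Main.v *)
Require Import Defs.
From HB Require Import structures.
From mathcomp Require Import all_boot all_order all_algebra.
From mathcomp Require Import all_classical all_reals all_analysis.
From mathcomp Require Import measurable_realfun ess_sup_inf ring lra.

Set Implicit Arguments.
Unset Strict Implicit.
Unset Printing Implicit Defensive.

Import Order.TTheory GRing.Theory Num.Theory.
Import numFieldNormedType.Exports.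

Local Open Scope classical_set_scope.
Local Open Scope ring_scope.

(* Lower bound: at a spatial minimum [Du = 0] and [Lap u >= 0], so the equation
   gives [u_t <= H(x, 0)], which is bounded; hence [u >= - M] with [M] depending
   only on the data.

   Upper bound: [v := u + M] is nonnegative and, since [H >= 0], satisfies
   [- v_t - Lap v <= f] with [f := g_eps(m)]. Instead of the heat kernel of the
   torus one can use any positive supersolution [k_t >= Lap k] that concentrates
   at a point [x0] as [t] decreases to [t0]; an explicit one is
     k(x, r) = e^(d pi^2 r) r^(-d/2) exp(- sum_i sin^2(pi x_i) / (4 pi^2 r)),
   for which [(k_r - Lap k) / k] is a sum of squares. Integrating
   [k(x - x0, t - t0) v(x, t)] over the torus and differentiating in [t] bounds
   [v(x0, t0)] by [v(., T)] plus the space-time integral of [k f]. The mass of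
   [k] is nondecreasing in [t], hence bounded, and [k <= C r^(-d/2)], so its
   [L^b'] norm is at most [C r^(- d / (2 b))]; this is in [L^a'(0, T)] exactly
   when [d / 2 < b (a - 1) / a], and Hoelder's inequality in space and in time
   concludes. *)

(** * Measurability of continuous functions *)

Section floor_approximation.
Context {R : realType}.

(** The lower bound has to come before the upper one. Pairing a mere supersolution [k] with [v]
    leaves the error term [(k_r - Lap k) v], whose sign is favourable only because [v] is
    nonnegative. Nor does [k] reproduce point values exactly: near its pole it is at least
    [expR (- d / 4)] times the inverse volume of a cube of side [sqrt r], and this fixed loss is
    absorbed into the constants.

    Uniformity in [eps] holds because the constants of the upper bound depend only on [d], [T], [a],
    [b], and those of the lower bound only on [T], a bound for [u0] and a bound for [H] at [p = 0].

    Two points of regularity shape the argument. The solution is the restriction to [0, T] of a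
    smooth function and the equation is given for 0 < t < T, so the work is done on the smooth
    extension, with the pole at an interior time. Moreover, measurability in time of the norms of
    [g_reg], a nested convolution, is not visible from its definition; the equation supplies it, by
    expressing [g_reg] through derivatives of [u]. *)

Definition grid_round (N : nat) (x : R) : R := (Num.floor (N.+1%:R * x))%:~R / N.+1%:R.

Lemma grid_round_bound N x : `|grid_round N x - x| <= N.+1%:R^-1.
Proof.
have N0 : (0 : R) < N.+1%:R by [].
rewrite /grid_round distrC ger0_norm.
  rewrite -(ler_pM2r N0) mulVf ?gt_eqF// mulrBl divfK ?gt_eqF// mulrC.
  by have := floorD1_gt (N.+1%:R * x); rewrite intrD; lra.
by rewrite subr_ge0 ler_pdivrMr// mulrC floor_le.
Qed.

Lemma measurable_floor_fiber N (k : int) :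
  measurable [set x : measurableTypeR R | Num.floor (N.+1%:R * (x : R)) = k].
Proof.
have N0 : (0 : R) < N.+1%:R by [].
rewrite (_ : [set _ | _] = `[(k%:~R / N.+1%:R : R), ((k + 1)%:~R / N.+1%:R : R)[%classic).
  exact: measurable_itv.
apply/seteqP; split => x /=; rewrite in_itv /= ler_pdivrMr// ltr_pdivlMr// [x * _]mulrC.
  by move=> <-; apply/andP; split; [exact: floor_le|exact: floorD1_gt].
by move=> /floor_def.
Qed.
End floor_approximation.

Lemma row_norm_le {R : realType} n (x : 'rV[R]_n) (e : R) : 0 <= e ->
  (forall i, `|x 0 i| <= e) -> `|x| <= e.
Proof.
move=> e0 xe; rewrite [leLHS]/Num.Def.normr /= mx_normrE; apply: bigmax_le => //.
by move=> [i j] _ /=; rewrite ord1; exact: xe.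
Qed.

Lemma row_entry_norm_le {R : realType} n (x : 'rV[R]_n) i : `|x 0 i| <= `|x|.
Proof.
rewrite [leRHS]/Num.Def.normr /= mx_normrE.
exact: (le_bigmax_cond _ (fun ij : 'I_1 * 'I_n => `|x ij.1 ij.2|) (isT : predT (0, i))).
Qed.

Section continuous_measurable.
Context {R : realType} {n : nat}.
Local Notation tup := (n.-tuple (measurableTypeR R)).

(* A continuous function is the limit of its values at points rounded to a grid,
   which take countably many values. *)
Lemma continuous_measurable_prod (K : 'rV[R]_n * R -> R) : continuous K ->
  measurable_fun [set: tup * measurableTypeR R] (fun z => K (row_of z.1, z.2)).
Proof.
move=> cK.
pose P := ({ffun 'I_n -> int} * int)%type.
pose G (N : nat) (z : tup * measurableTypeR R) : P :=
  ([ffun i => Num.floor (N.+1%:R * (tnth z.1 i : R))], Num.floor (N.+1%:R * (z.2 : R))).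
pose kap (N : nat) (p : P) : 'rV[R]_n * R :=
  (\row_i ((p.1 i)%:~R / N.+1%:R), p.2%:~R / N.+1%:R).
apply: (measurable_fun_cvg (h := fun N z => K (kap N (G N z)))).
  move=> N _ B mB; rewrite setTI.
  (* [G N] takes values in a countable type, so the preimage of [B] is a countable union, indexed by
     codes, of those fibers of [G N] whose grid value lies in [B]. *)
  rewrite (_ : _ @^-1` _ = \bigcup_(k in setT) (if unpickle k is Some p then
     if `[< B (K (kap N p)) >] then G N @^-1` [set p] else set0 else set0)); last first.
    apply/seteqP; split => z /=.
      move=> Bz; exists (pickle (G N z)) => //; rewrite pickleK.
      by rewrite (asboolT Bz).
    move=> [k _]; case: unpickle => // p.
    by case: asboolP => // Bp /= ->.
  apply: bigcup_measurable => k _; case: unpickle => // p.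
  case: asboolP => // _.
  rewrite (_ : _ @^-1` _ = (\bigcap_(i in [set: 'I_n])
    ((fun z : tup * measurableTypeR R => tnth z.1 i) @^-1`
       [set x : measurableTypeR R | Num.floor (N.+1%:R * (x : R)) = p.1 i])) `&`
       (snd @^-1` [set x : measurableTypeR R | Num.floor (N.+1%:R * (x : R)) = p.2])).
    apply: measurableI.
      apply: fin_bigcap_measurable => // i _.
      rewrite -[X in measurable X]setTI.
      apply: (measurableT_comp (f := @tnth n (measurableTypeR R) ^~ i) (g := fst)) => //.
        exact: measurable_tnth.
      exact: measurable_floor_fiber.
    rewrite -[X in measurable X]setTI.
    by apply: measurable_snd => //; exact: measurable_floor_fiber.
  apply/seteqP; split => z /=.
    by move=> <-; split => //= i _; rewrite /G/= ffunE.
  case: p => p1 p2 /= [zi z2]; rewrite /G; congr pair => //.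
  by apply/ffunP => i; rewrite ffunE; exact: zi.
move=> z _.
apply: continuous_cvg; first exact: cK.
have cv (x : R) : grid_round N x @[N --> \oo] --> x.
  apply/cvgrPdist_le => e e0; near=> N.
  rewrite distrC (le_trans (grid_round_bound _ _))//.
  by apply: ltW; near: N; exact: near_infty_natSinv_lt (PosNum e0).
have h1 : (kap N (G N z)).1 @[N --> \oo] --> row_of z.1.
  apply/cvgrPdist_le => e e0; near=> N.
  apply: row_norm_le => [|j]; first exact: ltW.
  rewrite !mxE !ffunE.
  suff : `|tnth z.1 j - grid_round N (tnth z.1 j)| <= e by [].
  rewrite distrC (le_trans (grid_round_bound _ _))//.
  by apply: ltW; near: N; exact: near_infty_natSinv_lt (PosNum e0).
exact: (cvg_pair h1 (cv z.2)).
Unshelve. all: by end_near. Qed.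

Lemma continuous_measurable_row (f : 'rV[R]_n -> R) : continuous f ->
  measurable_fun [set: tup] (fun y => f (row_of y)).
Proof.
move=> cf.
have /(_ _)mK : continuous (fun z : 'rV[R]_n * R => f z.1).
  by move=> z; apply: continuous_comp; [exact: cvg_fst|exact: cf].
apply: (measurableT_comp (f := fun z : tup * measurableTypeR R => f (row_of z.1))
  (g := fun y : tup => (y, 0 : measurableTypeR R))).
  exact: (continuous_measurable_prod mK).
exact: measurable_fun_pair.
Qed.

End continuous_measurable.

(** * Integration over cylinders *)

Section boxes.
Context {R : realType}.
Local Notation tup n := (n.-tuple (measurableTypeR R)).
Local Notation row_of := (@Defs.row_of R _).

Definition box {n} (a b : 'rV[R]_n) : set (tup n) :=
  [set y | forall i, a 0 i <= row_of y 0 i < b 0 i].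

Lemma cellE n : @cell R n = box 0 (const_mx 1).
Proof. by apply/seteqP; split => y yc i; have := yc i; rewrite !mxE. Qed.

Lemma box_fiber n (a b : 'rV[R]_n) :
  box a b = \bigcap_(i in [set: 'I_n])
    ((fun z : tup n => tnth z i) @^-1` `[(a 0 i), (b 0 i)[%classic).
Proof.
apply/seteqP; split => y /= yab i; first by move=> _; rewrite /= in_itv /=; have := yab i; rewrite mxE.
by have := yab i I; rewrite /= in_itv /= mxE.
Qed.

Lemma measurable_box n (a b : 'rV[R]_n) : measurable (box a b).
Proof.
rewrite box_fiber; apply: fin_bigcap_measurable => // i _.
rewrite -[X in measurable X]setTI; apply: measurable_tnth => //.
Qed.

Lemma measurable_cell n : measurable (@cell R n).
Proof. by rewrite cellE; exact: measurable_box. Qed.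

Definition row_cons {n} (w : 'rV[R]_n) (t : R) : 'rV[R]_n.+1 :=
  \row_i (if unlift ord0 i is Some j then w 0 j else t).

Lemma row_cons_ord0 n (w : 'rV[R]_n) t : row_cons w t 0 ord0 = t.
Proof. by rewrite mxE unlift_none. Qed.

Lemma row_cons_lift n (w : 'rV[R]_n) t j : row_cons w t 0 (lift ord0 j) = w 0 j.
Proof. by rewrite mxE liftK. Qed.

Lemma row_of_tuple_cons n (z : measurableTypeR R * tup n) :
  row_of (tuple_cons z) = row_cons (row_of z.2) z.1.
Proof.
apply/rowP => i; have [j ->|->] := unliftP ord0 i.
  by rewrite row_cons_lift !mxE tnthS.
by rewrite row_cons_ord0 mxE.
Qed.

Lemma box_tuple_cons n (a b : 'rV[R]_n.+1) : @tuple_cons _ _ n @^-1` (box a b) =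
  `[(a 0 ord0), (b 0 ord0)[%classic `*`
  box (\row_j a 0 (lift ord0 j)) (\row_j b 0 (lift ord0 j)).
Proof.
apply/seteqP; split => z /=.
  move=> zab; split => /=; first by rewrite in_itv /=; have := zab ord0;
    rewrite row_of_tuple_cons row_cons_ord0.
  by move=> j; have := zab (lift ord0 j); rewrite row_of_tuple_cons row_cons_lift !mxE.
move=> -[]; rewrite /= in_itv /= => z0 zab i; rewrite row_of_tuple_cons.
have [j ->|->] := unliftP ord0 i; last by rewrite row_cons_ord0.
by rewrite row_cons_lift; have := zab j; rewrite !mxE.
Qed.

Lemma cell_tuple_cons n : @tuple_cons _ _ n @^-1` (@cell R n.+1) = `[(0 : R), 1[%classic `*` cell.
Proof.
rewrite !cellE box_tuple_cons !mxE; congr (_ `*` box _ _);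
  by apply/rowP => j; rewrite !mxE.
Qed.

Lemma lebd_box n (a b : 'rV[R]_n) : (forall i, a 0 i <= b 0 i) ->
  @lebd R n (box a b) = (\prod_i (b 0 i - a 0 i))%:E.
Proof.
elim: n a b => [|n IHn] a b ab.
  (* In dimension 0 the measure is the Dirac mass at the empty tuple, which agrees with the empty
     product. *)
  rewrite big_ord0 /lebd /= diracE mem_set//.
  by move=> -[].
rewrite /lebd /= /power_step /pushforward box_tuple_cons.
rewrite product_measure1E; [|exact: measurable_itv|exact: measurable_box].
rewrite [X in (_ * X)%E](IHn); last by move=> i; rewrite !mxE.
rewrite big_ord_recl EFinM; congr (_ * _)%E.
  rewrite [LHS]lebesgue_measure_itv /= lte_fin -EFinB.
  have := ab ord0; rewrite le_eqVlt => /orP[/eqP->|->//].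
  by rewrite ltxx subrr.
by congr (_ %:E); apply: eq_bigr => i _; rewrite !mxE.
Qed.

Lemma lebd_cell n : @lebd R n cell = 1%E.
Proof.
rewrite cellE lebd_box => [|i]; last by rewrite !mxE.
by rewrite big1// => i _; rewrite !mxE subr0.
Qed.

End boxes.

(** * Fubini on the product of a time interval and the cell *)

Section fubini_cell.
Context {R : realType} {n : nat}.
Local Notation tup := (n.-tuple (measurableTypeR R)).
Implicit Types K : 'rV[R]_n -> R -> R.

Lemma continuous_measurable_swap K : continuous (fun z : 'rV[R]_n * R => K z.1 z.2) ->
  measurable_fun [set: measurableTypeR R * tup] (fun z => K (row_of z.2) z.1).
Proof.
move=> cK.
apply: (measurableT_comp (f := fun z : tup * measurableTypeR R => K (row_of z.1) z.2)
  (g := fun z : measurableTypeR R * tup => (z.2, z.1))).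
  exact: (continuous_measurable_prod cK).
exact: measurable_fun_pair.
Qed.

(** The half-open cell is not compact, so the extreme value theorem is applied on the closed
    cube. *)
Lemma continuous_cube_bounded K (alpha beta : R) :
  continuous (fun z : 'rV[R]_n * R => K z.1 z.2) ->
  exists M, forall (x : 'rV[R]_n) t, (forall i, 0 <= x 0 i <= 1) ->
    alpha <= t <= beta -> `|K x t| <= M.
Proof.
move=> cK.
have [ab|ab] := leP alpha beta; last first.
  by exists 0 => y t _ /andP[at_ tb]; have := le_lt_trans (le_trans at_ tb) ab; rewrite ltxx.
pose A : set ('rV[R]_n * R) :=
  [set v : 'rV[R]_n | forall i, `[(0:R), 1]%classic (v ord0 i)] `*` `[alpha, beta]%classic.
have cA : compact A.
  apply: compact_setX; last exact: segment_compact.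
  by apply: (@rV_compact _ _ (fun=> `[(0:R), 1]%classic)) => i; exact: segment_compact.
have [||z _ zmax] := @compact_EVT_max _ R (fun z => `|K z.1 z.2|) A _ cA.
- exists (0, alpha); split => /=; last by rewrite in_itv /= lexx.
  by move=> i; rewrite mxE /= in_itv /= lexx ler01.
- apply: continuous_subspaceT => z; apply: continuous_comp; first exact: cK.
  exact: norm_continuous.
exists `|K z.1 z.2| => x t xc tab.
apply: (zmax (x, t)); rewrite inE; split => [i|].
  by rewrite /= in_itv /=; exact: xc.
have : t \in `[alpha, beta] by rewrite in_itv.
exact.
Qed.

Lemma continuous_cell_bounded K (alpha beta : R) :
  continuous (fun z : 'rV[R]_n * R => K z.1 z.2) ->
  exists M, forall (y : tup) t, cell y -> alpha <= t <= beta -> `|K (row_of y) t| <= M.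
Proof.
move=> cK; have [M KM] := continuous_cube_bounded alpha beta cK.
by exists M => y t yc; apply: KM => i; have /andP[-> /ltW] := yc i.
Qed.

Lemma continuous_cell_integrable (f : 'rV[R]_n -> R) : continuous f ->
  (@lebd R n).-integrable cell (fun y => (f (row_of y))%:E).
Proof.
move=> cf; apply: (@measurable_bounded_integrable _ _ _ _ (fun y : tup => f (row_of y))).
- exact: measurable_cell.
- by rewrite [X in (X < _)%E]lebd_cell ltry.
- by apply: measurable_funTS; exact: continuous_measurable_row.
have cK : continuous (fun z : 'rV[R]_n * R => f z.1).
  by move=> z; apply: continuous_comp; [exact: cvg_fst|exact: cf].
have [M KM] := @continuous_cell_bounded (fun x _ => f x) 0 0 cK.
exists M; split; first exact: num_real.
move=> r Mr y /= yc; apply: le_trans (ltW Mr).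
by apply: (KM _ 0) => //; rewrite lexx.
Qed.

(** Fubini is applied on the full product space; this lemma and its mirror image turn the extension
    by zero off a rectangle into nested integrals over its sides. *)
Lemma restrict_setX_integral (T1 : Type) d (S : measurableType d) (mu : {measure set S -> \bar R})
  (A : set T1) (B : set S) (f : T1 * S -> \bar R) (x : T1) :
  (\int[mu]_y (f \_ (A `*` B)) (x, y) = ((fun x => \int[mu]_(y in B) f (x, y)) \_ A) x)%E.
Proof.
rewrite patchE; case: ifPn => [xA|xA].
  rewrite [RHS]integral_mkcond; apply: eq_integral => y _.
  by rewrite !patchE in_setX xA.
by rewrite integral0_eq// => y _; rewrite patchE in_setX (negbTE xA).
Qed.

Lemma restrict_setX_integralr (T1 : Type) d (S : measurableType d) (mu : {measure set S -> \bar R})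
  (A : set T1) (B : set S) (f : S * T1 -> \bar R) (x : T1) :
  (\int[mu]_y (f \_ (B `*` A)) (y, x) = ((fun x => \int[mu]_(y in B) f (y, x)) \_ A) x)%E.
Proof.
rewrite patchE; case: ifPn => [xA|xA].
  rewrite [RHS]integral_mkcond; apply: eq_integral => y _.
  by rewrite !patchE in_setX xA andbT.
by rewrite integral0_eq// => y _; rewrite patchE in_setX (negbTE xA) andbF.
Qed.

Variables (K : 'rV[R]_n -> R -> R) (alpha beta : R).
Hypothesis cK : continuous (fun z : 'rV[R]_n * R => K z.1 z.2).
Hypothesis ab : alpha <= beta.
Let I : set (measurableTypeR R) := `[alpha, beta[%classic.
Let F (z : measurableTypeR R * tup) : \bar R := (K (row_of z.2) z.1)%:E.

Let mI : measurable I. Proof. exact: measurable_itv. Qed.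

Lemma integrable_cylinder :
  (leb \x @lebd R n)%E.-integrable (I `*` cell) F.
Proof.
have mX := measurableX mI (@measurable_cell R n).
apply: (@measurable_bounded_integrable _ _ _ _ (fun z : measurableTypeR R * tup => K (row_of z.2) z.1)).
- exact: mX.
- rewrite [X in (X < _)%E](product_measure1E leb (@lebd R n) mI (@measurable_cell R n)).
  rewrite [X in (_ * X < _)%E](@lebd_cell R n) mule1 [X in (X < _)%E](@lebesgue_measure_itv R).
  by case: ifP; rewrite ?ltry//= -EFinB ltry.
- by apply: measurable_funTS; exact: continuous_measurable_swap.
have [M KM] := @continuous_cell_bounded K alpha beta cK.
exists M; split; first exact: num_real.
move=> r Mr y /= [yI yc]; apply: le_trans (ltW Mr).
by apply: KM => //; move: yI; rewrite /I /= in_itv /= => /andP[-> /ltW].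
Qed.

Let iF : (leb \x @lebd R n)%E.-integrable setT (F \_ (I `*` cell)).
Proof.
rewrite -integrable_mkcond; first exact: integrable_cylinder.
exact: measurableX mI (@measurable_cell R n).
Qed.

Lemma fubini_cylinder1 :
  (\int[leb]_(t in I) \int[@lebd R n]_(y in cell) (K (row_of y) t)%:E =
   \int[leb \x @lebd R n]_(z in I `*` cell) F z)%E.
Proof.
rewrite [RHS]integral_mkcond; apply: etrans (integral12_prod_meas1 iF).
rewrite [LHS]integral_mkcond; apply: eq_integral => t _; rewrite /fubini_F.
exact/esym/restrict_setX_integral.
Qed.

Lemma fubini_cylinder2 :
  (\int[@lebd R n]_(y in cell) \int[leb]_(t in I) (K (row_of y) t)%:E =
   \int[leb \x @lebd R n]_(z in I `*` cell) F z)%E.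
Proof.
rewrite [RHS]integral_mkcond; apply: etrans (integral21_prod_meas1 iF).
rewrite [LHS]integral_mkcond; apply: eq_integral => t _; rewrite /fubini_G.
exact/esym/restrict_setX_integralr.
Qed.

Lemma integrable_cell_integral :
  leb.-integrable I (fun t => \int[@lebd R n]_(y in cell) (K (row_of y) t)%:E)%E.
Proof.
rewrite integrable_mkcond//.
rewrite (_ : _ \_ _ = fubini_F (@lebd R n) (F \_ (I `*` cell))).
  exact: integrable_fubini_F iF.
by apply/funext => t; exact/esym/restrict_setX_integral.
Qed.

End fubini_cell.

(** * The divergence theorem on the torus *)

Lemma continuous_mul {T : topologicalType} {R : realType} (f g : T -> R) :
  continuous f -> continuous g -> continuous (fun x => f x * g x).
Proof. by move=> cf cg x; exact: (continuousM (cf x) (cg x)). Qed.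

Section continuity.
Context {T : topologicalType}.

Lemma continuous_pair_at {U V : topologicalType} (f : T -> U) (g : T -> V) x :
  {for x, continuous f} -> {for x, continuous g} ->
  {for x, continuous (fun y => (f y, g y))}.
Proof. by move=> cf cg; exact: (cvg_pair cf cg). Qed.

Lemma continuous_sum_at {R : realType} m (f : 'I_m -> T -> R) x :
  (forall i, {for x, continuous (f i)}) ->
  {for x, continuous (fun y => \sum_i f i y)}.
Proof.
elim: m f => [|m IHm] f cf.
  rewrite (_ : (fun _ => _) = cst 0); first exact: cvg_cst.
  by apply/funext => y; rewrite big_ord0.
rewrite (_ : (fun _ => _) = f ord0 \+ (fun y => \sum_i f (lift ord0 i) y)).
  by apply: continuousD; [exact: cf|apply: IHm => i; exact: cf].
by apply/funext => y; rewrite big_ord_recl.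
Qed.

End continuity.

Section torus_integral_theory.
Context {R : realType} {n : nat}.
Implicit Types f g : 'rV[R]_n -> R.

Lemma torus_integral_EFin f : continuous f ->
  (torus_integral f)%:E = (\int[@lebd R n]_(y in cell) (f (row_of y))%:E)%E.
Proof.
move=> cf; rewrite /torus_integral /Rintegral fineK//.
by apply: integrable_fin_num; [exact: measurable_cell|exact: continuous_cell_integrable].
Qed.

Lemma torus_integral_cst (c : R) : torus_integral (fun _ : 'rV[R]_n => c) = c.
Proof.
rewrite /torus_integral Rintegral_cst; last exact: measurable_cell.
by rewrite [X in fine X](@lebd_cell R n) mulr1.
Qed.

Lemma torus_integralD f g : continuous f -> continuous g ->
  torus_integral (fun x => f x + g x) = torus_integral f + torus_integral g.
Proof.
move=> cf cg; apply: RintegralD; first exact: measurable_cell.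
  exact: continuous_cell_integrable cf.
exact: continuous_cell_integrable cg.
Qed.

Lemma torus_integral_sum m (f : 'I_m -> 'rV[R]_n -> R) :
  (forall i, continuous (f i)) ->
  torus_integral (fun x => \sum_i f i x) = \sum_i torus_integral (f i).
Proof.
move=> cf; elim: m f cf => [|m IHm] f cf.
  rewrite big_ord0 -[RHS](torus_integral_cst 0); congr torus_integral.
  by apply/funext => x; rewrite big_ord0.
rewrite big_ord_recl -IHm// -torus_integralD//.
  by congr torus_integral; apply/funext => x; rewrite big_ord_recl.
move=> x; apply: continuous_sum_at => i; exact: cf.
Qed.

Lemma le_torus_integral f g : continuous f -> continuous g ->
  (forall x : 'rV[R]_n, (forall i, 0 <= x 0 i < 1) -> f x <= g x) ->
  torus_integral f <= torus_integral g.
Proof.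
move=> cf cg fg; apply: le_Rintegral.
- exact: measurable_cell.
- exact: continuous_cell_integrable cf.
- exact: continuous_cell_integrable cg.
by move=> y yc; apply: fg.
Qed.

End torus_integral_theory.

(** A directional derivative only sees the restriction to a line. This one transfer principle covers
    translations, time slices, coordinates of row vectors and pairs of a point and a time. *)
Lemma is_derive_line {R : numFieldType} {V V' W : normedModType R}
    (f : V -> W) (x v : V) (g : V' -> W) (x' v' : V') l :
  (forall h : R, f (h *: v + x) = g (h *: v' + x')) ->
  is_derive x v f l -> is_derive x' v' g l.
Proof.
move=> fg [df dfl].
have E : (fun h : R => h^-1 *: ((f \o shift x) (h *: v) - f x)) =
         (fun h : R => h^-1 *: ((g \o shift x') (h *: v') - g x')).
  apply/funext => h /=; rewrite fg; congr (_ *: (_ - _)).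
  by have := fg 0; rewrite !scale0r !add0r.
split; first by rewrite /derivable -E.
by rewrite /derive -E.
Qed.

(** * The fundamental theorem of calculus in time, under the space integral *)

Section fundamental_theorem_cylinder.
Context {R : realType}.

(* Clamping the time variable turns functions that are continuous only on a time
   slab, as the kernel is, into globally continuous, hence measurable, ones. *)
Definition clamp (alpha beta t : R) := Num.max alpha (Num.min t beta).

Lemma clamp_continuous alpha beta : continuous (clamp alpha beta).
Proof.
move=> t; apply: (@continuous_max _ _ (cst alpha) (fun t => Num.min t beta)); first exact: cvg_cst.
by apply: (@continuous_min _ _ id (cst beta)); [exact: cvg_id|exact: cvg_cst].
Qed.

Lemma clamp_in alpha beta t : alpha <= beta -> alpha <= clamp alpha beta t <= beta.
Proof. by move=> ab; rewrite /clamp le_max lexx ge_max ab ge_min lexx orbT. Qed.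

Lemma clamp_id alpha beta t : alpha <= t <= beta -> clamp alpha beta t = t.
Proof. by move=> /andP[at_ tb]; rewrite /clamp min_l// max_r. Qed.

Context {n : nat}.

Lemma clamp_continuous_cylinder (L : 'rV[R]_n -> R -> R) (alpha beta : R) :
  alpha <= beta ->
  (forall x t, alpha <= t <= beta -> {for (x, t), continuous (fun z => L z.1 z.2)}) ->
  continuous (fun z : 'rV[R]_n * R => L z.1 (clamp alpha beta z.2)).
Proof.
move=> ab cL z.
apply: (@continuous_comp _ _ _ (fun z : 'rV[R]_n * R => (z.1, clamp alpha beta z.2))
   (fun z => L z.1 z.2)); last by apply: cL; exact: clamp_in.
apply: continuous_pair_at.
  exact: cvg_fst.
apply: (@continuous_comp _ _ _ snd (clamp alpha beta)); first exact: cvg_snd.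
exact: clamp_continuous.
Qed.

Lemma slice_continuous (L : 'rV[R]_n -> R -> R) t :
  (forall x, {for (x, t), continuous (fun z => L z.1 z.2)}) ->
  continuous (L ^~ t).
Proof.
move=> cL x; apply: (@continuous_comp _ _ _ (fun x => (x, t)) (fun z => L z.1 z.2)).
  by apply: continuous_pair_at; [exact: cvg_id|exact: cst_continuous].
exact: cL.
Qed.

Section cylinder.
Variables (G L : 'rV[R]_n -> R -> R) (alpha beta : R).
Hypothesis ab : alpha < beta.
Hypothesis cL : forall x t, alpha <= t <= beta ->
  {for (x, t), continuous (fun z => L z.1 z.2)}.

Let cLc := clamp_continuous_cylinder (ltW ab) cL.

Let Lt t : alpha <= t <= beta -> continuous (L^~ t).
Proof. by move=> tab; apply: slice_continuous => x; exact: cL. Qed.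

Lemma integrable_torus_integral :
  leb.-integrable `[alpha, beta[ (fun t => (torus_integral (L ^~ t))%:E).
Proof.
apply: eq_integrable
  (integrable_cell_integral (K := fun x t => L x (clamp alpha beta t)) alpha beta cLc) => //=.
move=> t; rewrite inE /= in_itv /= => /andP[at_ /ltW tb].
have tab : alpha <= t <= beta by rewrite at_.
rewrite torus_integral_EFin; last exact: Lt.
by rewrite clamp_id.
Qed.

Hypothesis dG : forall x t, alpha <= t <= beta -> is_derive t 1 (G x) (L x t).
Hypothesis cGa : continuous (G ^~ alpha).
Hypothesis cGb : continuous (G ^~ beta).

Let FTC x : (\int[leb]_(t in `[alpha, beta[) (L x (clamp alpha beta t))%:E =
  (G x beta)%:E - (G x alpha)%:E)%E.
Proof.
have cGx t : alpha <= t <= beta -> {for t, continuous (G x)}.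
  by move=> tab; apply/differentiable_continuous/derivable1_diffP; have [] := dG x tab.
have cLx : continuous (fun t => L x (clamp alpha beta t)).
  move=> t; apply: (@continuous_comp _ _ _ (fun t => (x, t)) (fun z => L z.1 (clamp alpha beta z.2))).
    by apply: continuous_pair_at; [exact: cst_continuous|exact: cvg_id].
  exact: cLc.
rewrite [LHS]integral_itv_bndo_bndc; last first.
  apply: measurable_funTS; apply/measurable_EFinP; exact: continuous_measurable_fun.
apply: continuous_FTC2 => //.
- exact: continuous_subspaceT.
- split => /=.
  + move=> t; rewrite in_itv /= => /andP[/ltW at_ /ltW tb].
    by have [] : is_derive t 1 (G x) (L x t) by apply: dG; rewrite at_.
  + by apply: cvg_at_right_filter; apply: cGx; rewrite lexx ltW.
  + by apply: cvg_at_left_filter; apply: cGx; rewrite lexx ltW.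
move=> t; rewrite in_itv /= => /andP[/ltW at_ /ltW tb].
have tab : alpha <= t <= beta by rewrite at_.
by rewrite derive1E clamp_id//; apply: derive_val; exact: dG.
Qed.

(** Exchanging the integrals reduces the claim to the fundamental theorem on each time line; no
    differentiation under the integral sign is involved. *)
Lemma cylinder_FTC :
  (\int[leb]_(t in `[alpha, beta[) (torus_integral (L ^~ t))%:E =
   (torus_integral (G ^~ beta) - torus_integral (G ^~ alpha))%:E)%E.
Proof.
transitivity (\int[leb]_(t in `[alpha, beta[)
  \int[@lebd R n]_(y in cell) (L (row_of y) (clamp alpha beta t))%:E)%E.
  apply: eq_integral => t; rewrite inE /= in_itv /= => /andP[at_ /ltW tb].
  have tab : alpha <= t <= beta by rewrite at_.
  rewrite torus_integral_EFin; last exact: Lt.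
  by rewrite clamp_id.
rewrite (fubini_cylinder1 (K := fun x t => L x (clamp alpha beta t)) alpha beta cLc)
  -(fubini_cylinder2 (K := fun x t => L x (clamp alpha beta t)) alpha beta cLc).
rewrite EFinB !torus_integral_EFin// -integralB_EFin//=; last 3 first.
- exact: measurable_cell.
- exact: (continuous_cell_integrable cGb).
- exact: (continuous_cell_integrable cGa).
apply: eq_integral => y _; exact: FTC.
Qed.

End cylinder.
End fundamental_theorem_cylinder.

Section divergence_theorem.
Context {R : realType}.

Lemma row_cons_continuous n :
  continuous (fun z : 'rV[R]_n * R => row_cons z.1 z.2).
Proof.
move=> z; apply/cvgrPdist_le => e e0.
have c1 : (fun z : 'rV[R]_n * R => z.1) x @[x --> z] --> z.1 by exact: cvg_fst.
have c2 : (fun z : 'rV[R]_n * R => z.2) x @[x --> z] --> z.2 by exact: cvg_snd.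
have /cvgrPdist_le/(_ e e0) n1 := c1; have /cvgrPdist_le/(_ e e0) n2 := c2.
near=> z'; apply: row_norm_le => [|i]; first exact: ltW.
rewrite !mxE; case: unliftP => [j _|_].
  suff : `|z.1 0 j - z'.1 0 j| <= e by [].
  have := row_entry_norm_le (z.1 - z'.1) j; rewrite !mxE => /le_trans; apply.
  by near: z'.
by near: z'.
Unshelve. all: by end_near. Qed.

Lemma row_cons_line n (w : 'rV[R]_n) (t h : R) :
  h *: unitv ord0 + row_cons w t = row_cons w (h *: 1 + t).
Proof.
apply/rowP => i; rewrite [LHS]mxE [in X in X + _]mxE /unitv mxE eqxx /=.
have [j ->|->] := unliftP ord0 i; last by rewrite eqxx !row_cons_ord0.
by rewrite !row_cons_lift /= mulr0 add0r.
Qed.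

Lemma row_cons_line_lift n (w : 'rV[R]_n) (t h : R) (j : 'I_n) :
  h *: unitv (lift ord0 j) + row_cons w t = row_cons (h *: unitv j + w) t.
Proof.
apply/rowP => i; rewrite [LHS]mxE [in X in X + _]mxE /unitv mxE eqxx /=.
have [k ->|->] := unliftP ord0 i; last by rewrite !row_cons_ord0 mulr0 add0r.
by rewrite !row_cons_lift !mxE eqxx (inj_eq lift_inj).
Qed.

(** By construction [lebd] in dimension [n.+1] is the push-forward of [leb \x lebd] under
    [tuple_cons]. The first coordinate can thus play the role of time in the cylinder lemmas. *)
Lemma torus_integral_row_cons n (f : 'rV[R]_n.+1 -> R) : continuous f ->
  (torus_integral f)%:E =
  (\int[leb]_(t in `[(0 : R)%R, 1%R[%classic) (torus_integral (fun w => f (row_cons w t)))%:E)%E.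
Proof.
move=> cf.
pose K (w : 'rV[R]_n) t := f (row_cons w t).
have cK : continuous (fun z : 'rV[R]_n * R => K z.1 z.2).
  by move=> z; apply: continuous_comp; [exact: row_cons_continuous|exact: cf].
have iK := integrable_cylinder 0 1 cK.
transitivity (\int[leb]_(t in `[0%R, 1%R[%classic) \int[@lebd R n]_(y in cell) (K (row_of y) t)%:E)%E.
  rewrite torus_integral_EFin// (fubini_cylinder1 0 1 cK).
  rewrite [LHS](integral_pushforward (@measurable_tuple_cons _ _ n) (mu := (leb \x @lebd R n)%E)).
  - rewrite cell_tuple_cons; apply: eq_integral => z _ /=; by rewrite row_of_tuple_cons.
  - by apply/measurable_EFinP; exact: continuous_measurable_row.
  - rewrite cell_tuple_cons (_ : _ \o _ = fun z => (K (row_of z.2) z.1)%:E)//.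
    by apply/funext => z /=; rewrite row_of_tuple_cons.
  - exact: measurable_cell.
apply: eq_integral => t _; rewrite torus_integral_EFin//.
by apply: (slice_continuous (L := K)) => x; exact: cK.
Qed.

(** Induction on the dimension. For a later coordinate the integral vanishes on every slice; for the
    first one, [cylinder_FTC] on [0, 1] leaves the difference of two opposite faces, which cancel by
    periodicity. *)
Lemma torus_integral_derive n (i : 'I_n) (f f' : 'rV[R]_n -> R) :
  continuous f -> continuous f' ->
  (forall x, is_derive x (unitv i) f (f' x)) ->
  (forall x, f (x + unitv i) = f x) -> torus_integral f' = 0.
Proof.
elim: n => [|n IHn] in i f f' *; first by case: i.
move=> cf cf' df fp; apply/EFin_inj; rewrite torus_integral_row_cons//.
have cr (k : 'rV[R]_n.+1 -> R) : continuous k ->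
    continuous (fun z : 'rV[R]_n * R => k (row_cons z.1 z.2)).
  by move=> ck z; apply: continuous_comp; [exact: row_cons_continuous|exact: ck].
have crt (k : 'rV[R]_n.+1 -> R) t : continuous k -> continuous (fun w => k (row_cons w t)).
  by move=> ck; apply: (slice_continuous (L := fun w t => k (row_cons w t))) => x; exact: cr.
have [j ij|i0] := unliftP ord0 i.
  rewrite integral0_eq// => t _; congr (_%:E).
  apply: (IHn j (fun w => f (row_cons w t))); [exact: crt|exact: crt| |].
    move=> w; apply: is_derive_line (df (row_cons w t)) => h.
    by rewrite ij row_cons_line_lift.
  move=> w; rewrite -[RHS]fp ij; congr f.
  by have := row_cons_line_lift w t 1 j; rewrite !scale1r [LHS]addrC [unitv j + w]addrC => ->.
pose L (w : 'rV[R]_n) t := f' (row_cons w t); pose G (w : 'rV[R]_n) t := f (row_cons w t).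
have dG (w : 'rV[R]_n) (t : R) : 0 <= t <= 1 -> is_derive t 1 (G w) (L w t).
  move=> _; apply: is_derive_line (df (row_cons w t)) => h.
  by rewrite i0 row_cons_line.
have cL (w : 'rV[R]_n) (t : R) : 0 <= t <= 1 -> {for (w, t), continuous (fun z => L z.1 z.2)}.
  by move=> _; exact: cr.
apply: etrans (cylinder_FTC ltr01 cL dG (crt _ _ cf) (crt _ _ cf)) _.
congr (_%:E); apply/eqP; rewrite subr_eq0; apply/eqP; congr torus_integral.
apply/funext => w; rewrite /G -[RHS]fp i0; congr f.
by have := row_cons_line w 0 1; rewrite !scale1r addr0 => <-; rewrite addrC.
Qed.

End divergence_theorem.

(** * A periodic supersolution of the heat equation *)

Section kernel.
Context {R : realType}.
Implicit Types (r z : R).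

(* A smooth 1-periodic substitute for [z ^+ 2 / 4]. *)
Definition bump z : R := sin (pi * z) ^+ 2 / (4 * pi ^+ 2).
Definition bump1 z : R := sin (pi * z) * cos (pi * z) / (2 * pi).
Definition bump2 z : R := (cos (pi * z) ^+ 2 - sin (pi * z) ^+ 2) / 2.

Lemma pi_neq0 : pi != 0 :> R. Proof. by rewrite gt_eqF// pi_gt0. Qed.

Lemma is_derive_bump z : is_derive z 1 bump (bump1 z).
Proof.
rewrite /bump; apply: is_derive_eq.
rewrite /bump1 /GRing.scale /=; have := pi_neq0; move: (pi : R) => p p0.
by field.
Qed.

Lemma is_derive_bump1 z : is_derive z 1 bump1 (bump2 z).
Proof.
rewrite /bump1; apply: is_derive_eq.
rewrite /bump2 /GRing.scale /=; have := pi_neq0; move: (pi : R) => p p0.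
by field.
Qed.

Lemma continuous_bump : continuous bump.
Proof. by move=> z; apply/differentiable_continuous/derivable1_diffP; have [] := is_derive_bump z. Qed.

Lemma continuous_bump1 : continuous bump1.
Proof. by move=> z; apply/differentiable_continuous/derivable1_diffP; have [] := is_derive_bump1 z. Qed.

Lemma continuous_bump2 : continuous bump2.
Proof.
move=> z; apply/differentiable_continuous/derivable1_diffP.
by rewrite /bump2; apply: ex_derive.
Qed.

Lemma bump_periodic z : bump (z + 1) = bump z.
Proof. by rewrite /bump mulrDr mulr1 sinDpi sqrrN. Qed.

Lemma bump1_periodic z : bump1 (z + 1) = bump1 z.
Proof. by rewrite /bump1 mulrDr mulr1 sinDpi cosDpi mulrNN. Qed.

Lemma bump_ge0 z : 0 <= bump z.
Proof. by rewrite divr_ge0// ?sqr_ge0// mulr_ge0// sqr_ge0. Qed.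

Lemma sin_norm_le z : `|sin z| <= `|z|.
Proof.
suff P (y : R) : 0 <= y -> `|sin y| <= y.
  have [z0|z0] := leP 0 z; first by rewrite [leRHS]ger0_norm// P.
  by rewrite -normrN -sinN [leRHS]ltr0_norm// P// oppr_ge0 ltW.
rewrite le_eqVlt => /predU1P[<-|y0]; first by rewrite sin0 normr0.
have [|c _] := @MVT R sin cos 0 y y0.
  by apply: continuous_subspaceT; exact: continuous_sin.
rewrite sin0 !subr0 => ->; rewrite normrM (gtr0_norm y0) ler_piMl ?(ltW y0)//.
by rewrite ler_norml cos_le1 cos_geN1.
Qed.

Lemma bump_le z : bump z <= z ^+ 2 / 4.
Proof.
have p0 := pi_gt0 R.
rewrite /bump ler_pdivrMr ?mulr_gt0 ?exprn_gt0//.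
have -> : z ^+ 2 / 4 * (4 * pi ^+ 2) = (pi * z) ^+ 2 by field.
by rewrite -[leLHS]real_normK ?num_real// -[leRHS]real_normK ?num_real// ler_sqr ?nnegrE// sin_norm_le.
Qed.

(* The square on the right is what makes [kern] a supersolution. *)
Lemma bump_identity z r : 0 < r ->
  pi ^+ 2 - (2 * r)^-1 + bump z / r ^+ 2 - ((bump1 z / r) ^+ 2 - bump2 z / r)
  = pi ^+ 2 * (1 - 2 * (bump z / r)) ^+ 2.
Proof.
move=> r0; have rn0 : r != 0 by rewrite gt_eqF.
have := pi_neq0; rewrite /bump1 /bump2 /bump exprMn_comm; last by rewrite /GRing.comm mulrC.
rewrite !exprMn cos2sin2; move: (pi : R) (sin _) => p s p0.
by field; rewrite p0 rn0.
Qed.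

Lemma is_derive_expR_div (b : R -> R) (b' m s r z : R) : is_derive z 1 b b' ->
  is_derive z 1 (fun h => expR (m - (b h + s) / r)) (- (b' / r) * expR (m - (b z + s) / r)).
Proof.
by move=> db; apply: is_derive_eq; rewrite /GRing.scale /=; ring.
Qed.

Lemma is_derive_oppr_div (b : R -> R) (b' r z : R) : is_derive z 1 b b' ->
  is_derive z 1 (fun h => - (b h / r)) (- (b' / r)).
Proof.
by move=> db; apply: is_derive_eq; rewrite /GRing.scale /=; ring.
Qed.

Lemma is_derive_kern_exponent (m p s r : R) : 0 < r ->
  is_derive r 1 (fun r => m * (p * r - ln r / 2) - s / r)
    (m * (p - (2 * r)^-1) + s / r ^+ 2).
Proof.
move=> r0; have rn0 : r != 0 by rewrite gt_eqF.
have dln := is_derive1_ln r0; have dV := is_deriveV rn0 (is_derive_id r 1).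
by apply: is_derive_eq; rewrite /GRing.scale /=; field.
Qed.

Context {n : nat}.
Implicit Types (x : 'rV[R]_n).

Definition bumps x : R := \sum_i bump (x 0 i).

(* Up to the factor [expR (n * pi ^ 2 * r)], this is [r ^ (- n / 2)] times the
   Gaussian [expR (- |x| ^ 2 / (4 * r))] made periodic by replacing each
   [x_i ^ 2 / 4] by [bump (x_i)]. *)
Definition kern x r : R := expR (n%:R * (pi ^+ 2 * r - ln r / 2) - bumps x / r).
Definition kern1 i x r : R := - (bump1 (x 0 i) / r) * kern x r.
Definition kern2 i x r : R :=
  ((bump1 (x 0 i) / r) ^+ 2 - bump2 (x 0 i) / r) * kern x r.
Definition kernt x r : R :=
  (n%:R * (pi ^+ 2 - (2 * r)^-1) + bumps x / r ^+ 2) * kern x r.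

Lemma kern_gt0 x r : 0 < kern x r. Proof. exact: expR_gt0. Qed.

Lemma is_derive_kern_time x r : 0 < r -> is_derive r 1 (kern x) (kernt x r).
Proof.
move=> r0; rewrite /kernt mulrC.
exact: (is_derive1_comp _ (is_derive_kern_exponent n%:R (pi ^+ 2) (bumps x) r0)).
Qed.

Lemma bumps_line i x (h : R) :
  bumps (h *: unitv i + x) = bump (h + x 0 i) + \sum_(j | j != i) bump (x 0 j).
Proof.
rewrite /bumps (bigD1 i)//=; congr (bump _ + _).
  by rewrite !mxE !eqxx mulr1.
by apply: eq_bigr => j ji; rewrite !mxE (negbTE ji) andbF mulr0 add0r.
Qed.

Lemma is_derive_kern i x r : is_derive x (unitv i) (kern ^~ r) (kern1 i x r).
Proof.
pose f h := expR (n%:R * (pi ^+ 2 * r - ln r / 2) - (bump h + \sum_(j | j != i) bump (x 0 j)) / r).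
apply: (@is_derive_line _ _ _ _ f (x 0 i) 1).
  by move=> h; rewrite /f /kern bumps_line /GRing.scale /= mulr1.
have -> : kern1 i x r = - (bump1 (x 0 i) / r) * f (x 0 i).
  rewrite /kern1; congr (_ * _).
  by rewrite /kern /f -(add0r x) -(scale0r (unitv i)) bumps_line scale0r !add0r.
exact: is_derive_expR_div (is_derive_bump _).
Qed.

Lemma is_derive_kern1 i x r : is_derive x (unitv i) (kern1 i ^~ r) (kern2 i x r).
Proof.
have dk := is_derive_kern i x r.
have db : is_derive x (unitv i) (fun x => - (bump1 (x 0 i) / r)) (- (bump2 (x 0 i) / r)).
  apply: (@is_derive_line _ _ _ _ (fun h => - (bump1 h / r)) (x 0 i) 1).
    by move=> h; rewrite !mxE !eqxx /= mulr1 /GRing.scale /= mulr1.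
  exact: is_derive_oppr_div (is_derive_bump1 _).
have := is_deriveM db dk; rewrite (_ : _ + _ = kern2 i x r)//.
by rewrite /kern2 /kern1 /GRing.scale /=; ring.
Qed.

(** Without the exponential growth factor, each coordinate would contribute to [(k_r - Lap k) / k]
    the quantity [b / r^2 - 1 / (2 r) - (b' / r)^2 + b'' / r = pi^2 ((1 - 2 b / r)^2 - 1)], with [b]
    the bump. The rate [pi ^+ 2] in [kern] is exactly what completes the square. *)
Lemma kern_supersolution x r : 0 < r -> \sum_i kern2 i x r <= kernt x r.
Proof.
move=> r0; rewrite -subr_ge0.
have -> : kernt x r = \sum_i (pi ^+ 2 - (2 * r)^-1 + bump (x 0 i) / r ^+ 2) * kern x r.
  rewrite -mulr_suml big_split /= sumr_const card_ord -mulr_suml.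
  by rewrite /kernt /bumps mulr_natl.
rewrite -sumrB; apply: sumr_ge0 => i _; rewrite -mulrBl bump_identity//.
by rewrite mulr_ge0 ?(ltW (kern_gt0 _ _))// mulr_ge0 ?sqr_ge0.
Qed.

Lemma entry_unitv i j x : (x + unitv i) 0 j = if j == i then x 0 j + 1 else x 0 j.
Proof. by rewrite !mxE eqxx /=; case: eqP; rewrite ?addr0. Qed.

Lemma kern_periodic i x r : kern (x + unitv i) r = kern x r.
Proof.
rewrite /kern; suff -> : bumps (x + unitv i) = bumps x by [].
by apply: eq_bigr => j _; rewrite entry_unitv; case: eqP; rewrite ?bump_periodic.
Qed.

Lemma kern1_periodic i j x r : kern1 j (x + unitv i) r = kern1 j x r.
Proof.
by rewrite /kern1 kern_periodic entry_unitv; case: eqP; rewrite ?bump1_periodic.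
Qed.

Lemma kern_le x r : 0 < r -> kern x r <= expR (n%:R * (pi ^+ 2 * r - ln r / 2)).
Proof.
move=> r0; rewrite ler_expR gerBl divr_ge0 ?(ltW r0)//.
by apply: sumr_ge0 => i _; exact: bump_ge0.
Qed.

(** In this range [bump_le] bounds each bump by [r / 4], the factor [sqrt r ^ n] cancels
    [r ^ (- n / 2)], and the growth factor, being at least 1, is dropped. *)
Lemma kern_ge x r : 0 < r -> (forall i, x 0 i ^+ 2 <= r) ->
  expR (- (n%:R / 4)) <= kern x r * Num.sqrt r ^+ n.
Proof.
move=> r0 xr.
have -> : Num.sqrt r ^+ n = expR (n%:R * (ln r / 2)).
  rewrite expRM_natl; congr (_ ^+ _).
  have -> : ln r = 2 * ln (Num.sqrt r).
    by rewrite -{1}(sqr_sqrtr (ltW r0)) lnXn ?sqrtr_gt0// mulr_natl.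
  by rewrite mulrC mulKf ?pnatr_eq0// lnK// posrE sqrtr_gt0.
rewrite /kern -expRD ler_expR.
have : bumps x / r <= n%:R / 4.
  rewrite ler_pdivrMr// (le_trans (y := \sum_(i < n) r / 4))//.
    by apply: ler_sum => i _; rewrite (le_trans (bump_le _))// ler_pM2r// invr_gt0.
  by rewrite sumr_const card_ord -mulr_natl; lra.
have : 0 <= n%:R * (pi ^+ 2 * r) by rewrite mulr_ge0// mulr_ge0 ?sqr_ge0 ?ltW.
lra.
Qed.

Section kernel_continuity.
Variables (x : 'rV[R]_n) (r : R).
Hypothesis r0 : 0 < r.
Let rn0 : r != 0. Proof. by rewrite gt_eqF. Qed.
Local Notation P := ('rV[R]_n * R)%type.

Let c1 (f : R -> R) i : continuous f -> {for (x, r), continuous (fun z : P => f (z.1 0 i))}.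
Proof.
move=> cf; apply: (@continuous_comp _ _ _ (fun z : P => z.1 0 i) f); last exact: cf.
apply: (@continuous_comp _ _ _ fst (fun y : 'rV[R]_n => y 0 i)); first exact: cvg_fst.
exact: coord_continuous.
Qed.

Let c2 : {for (x, r), continuous (fun z : P => z.2)}.
Proof. exact: cvg_snd. Qed.

Let c2V : {for (x, r), continuous (fun z : P => z.2^-1)}.
Proof. exact: continuousV. Qed.

Let cc c : {for (x, r), continuous (fun z : P => c : R)}.
Proof. exact: cst_continuous. Qed.

Let cX (f : P -> R) : {for (x, r), continuous f} ->
  {for (x, r), continuous (fun z : P => f z ^+ 2)}.
Proof. by move=> cf; exact: (continuousM cf cf). Qed.

Let cb : {for (x, r), continuous (fun z : P => bumps z.1)}.
Proof. by apply: continuous_sum_at => i; apply: c1; exact: continuous_bump. Qed.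

Lemma continuous_kern : {for (x, r), continuous (fun z : P => kern z.1 z.2)}.
Proof.
apply: (@continuous_comp _ _ _ (fun z : P => n%:R * (pi ^+ 2 * z.2 - ln z.2 / 2) - bumps z.1 / z.2) expR);
  last exact: continuous_expR.
apply: continuousB; last exact: continuousM.
apply: continuousM => //; apply: continuousB; first exact: continuousM.
apply: continuousM => //.
apply: (@continuous_comp _ _ _ snd (@ln R)); first exact: c2.
exact: continuous_ln.
Qed.

Lemma continuous_kern1 i : {for (x, r), continuous (fun z : P => kern1 i z.1 z.2)}.
Proof.
apply: continuousM; last exact: continuous_kern.
apply: continuousN; apply: continuousM => //.
by apply: c1; exact: continuous_bump1.
Qed.

Lemma continuous_kern2 i : {for (x, r), continuous (fun z : P => kern2 i z.1 z.2)}.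
Proof.
apply: continuousM; last exact: continuous_kern.
apply: continuousB.
  apply: cX; apply: continuousM => //.
  by apply: c1; exact: continuous_bump1.
apply: continuousM => //.
by apply: c1; exact: continuous_bump2.
Qed.

Lemma continuous_kernt : {for (x, r), continuous (fun z : P => kernt z.1 z.2)}.
Proof.
apply: continuousM; last exact: continuous_kern.
apply: continuousD.
  apply: continuousM => //; apply: continuousB => //.
  apply: continuousV; first by rewrite mulf_neq0.
  exact: continuousM.
apply: continuousM => //.
apply: continuousV; first by rewrite expf_neq0.
exact: cX.
Qed.

End kernel_continuity.
End kernel.

(** * Duality with the kernel *)

Section duality.
Context {R : realType} {n : nat}.

(** The derivatives are separate arguments so that their joint continuity in space and time can be
    stated. Everything is required at all real times, as for the smooth extension of a solution; the
    differential inequality and periodicity are assumed separately, on the times where they hold. *)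
Record parabolic_jet (v vt : 'rV[R]_n -> R -> R) (v1 v2 : 'I_n -> 'rV[R]_n -> R -> R) : Prop := {
  jet_continuous : continuous (fun z : 'rV[R]_n * R => v z.1 z.2);
  jet_continuous_t : continuous (fun z : 'rV[R]_n * R => vt z.1 z.2);
  jet_continuous_1 : forall i, continuous (fun z : 'rV[R]_n * R => v1 i z.1 z.2);
  jet_continuous_2 : forall i, continuous (fun z : 'rV[R]_n * R => v2 i z.1 z.2);
  jet_derive_t : forall x (t : R), is_derive t 1 (v x) (vt x t);
  jet_derive_1 : forall i x t, is_derive x (unitv i) (v ^~ t) (v1 i x t);
  jet_derive_2 : forall i x t, is_derive x (unitv i) (v1 i ^~ t) (v2 i x t)
}.

Variables (x0 : 'rV[R]_n) (t0 : R).

Let rho (x : 'rV[R]_n) (t : R) : R := kern (x - x0) (t - t0).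
Let rhot (x : 'rV[R]_n) (t : R) : R := kernt (x - x0) (t - t0).
Let rho1 i (x : 'rV[R]_n) (t : R) : R := kern1 i (x - x0) (t - t0).
Let rho2 i (x : 'rV[R]_n) (t : R) : R := kern2 i (x - x0) (t - t0).

Lemma continuous_shift (K : 'rV[R]_n -> R -> R) x t :
  {for (x - x0, t - t0), continuous (fun z : 'rV[R]_n * R => K z.1 z.2)} ->
  {for (x, t), continuous (fun z : 'rV[R]_n * R => K (z.1 - x0) (z.2 - t0))}.
Proof.
move=> cK.
apply: (@continuous_comp _ _ _ (fun z : 'rV[R]_n * R => (z.1 - x0, z.2 - t0)) (fun z => K z.1 z.2));
  last exact: cK.
by apply: continuous_pair_at; apply: continuousB;
  [exact: cvg_fst|exact: cst_continuous|exact: cvg_snd|exact: cst_continuous].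
Qed.

Let rtime t : t0 < t -> 0 < t - t0. Proof. by rewrite subr_gt0. Qed.

Let crho x t : t0 < t -> {for (x, t), continuous (fun z => rho z.1 z.2)}.
Proof. by move=> /rtime t0t; apply: continuous_shift; exact: continuous_kern. Qed.

Let crhot x t : t0 < t -> {for (x, t), continuous (fun z => rhot z.1 z.2)}.
Proof. by move=> /rtime t0t; apply: continuous_shift; exact: continuous_kernt. Qed.

Let crho1 i x t : t0 < t -> {for (x, t), continuous (fun z => rho1 i z.1 z.2)}.
Proof. by move=> /rtime t0t; apply: (continuous_shift (K := kern1 i)); exact: continuous_kern1. Qed.

Let crho2 i x t : t0 < t -> {for (x, t), continuous (fun z => rho2 i z.1 z.2)}.
Proof. by move=> /rtime t0t; apply: (continuous_shift (K := kern2 i)); exact: continuous_kern2. Qed.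

Let drhot x t : t0 < t -> is_derive t 1 (rho x) (rhot x t).
Proof.
move=> /rtime t0t; apply: is_derive_line (is_derive_kern_time (x - x0) t0t) => h.
by rewrite /rho /GRing.scale /= addrA.
Qed.

Let drho1 i x t : is_derive x (unitv i) (rho ^~ t) (rho1 i x t).
Proof. by apply: is_derive_line (is_derive_kern i (x - x0) (t - t0)) => h; rewrite /rho addrA. Qed.

Let drho2 i x t : is_derive x (unitv i) (rho1 i ^~ t) (rho2 i x t).
Proof. by apply: is_derive_line (is_derive_kern1 i (x - x0) (t - t0)) => h; rewrite /rho1 addrA. Qed.

Variables (v vt : 'rV[R]_n -> R -> R) (v1 v2 : 'I_n -> 'rV[R]_n -> R -> R).
Hypothesis jet : parabolic_jet v vt v1 v2.
Let cv := jet_continuous jet.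
Let cvt := jet_continuous_t jet.
Let cv1 := jet_continuous_1 jet.
Let cv2 := jet_continuous_2 jet.
Let dvt := jet_derive_t jet.
Let dv1 := jet_derive_1 jet.
Let dv2 := jet_derive_2 jet.

Let slice t (K : 'rV[R]_n -> R -> R) :
  continuous (fun z : 'rV[R]_n * R => K z.1 z.2) -> continuous (K ^~ t).
Proof. by move=> cK; apply: slice_continuous => x; exact: cK. Qed.

(** Green's identity, one coordinate at a time: the integrand is the [i]-th derivative of the
    periodic function [rho * v1 i - rho1 i * v]. *)
Lemma kern_green i t : t0 < t ->
  (forall x, v (x + unitv i) t = v x t) ->
  (forall x, v1 i (x + unitv i) t = v1 i x t) ->
  torus_integral (fun x => rho x t * v2 i x t - rho2 i x t * v x t) = 0.
Proof.
move=> t0t pv pv1.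
have sr : continuous (rho ^~ t) by apply: slice_continuous => x; exact: crho.
have sr1 : continuous (rho1 i ^~ t) by apply: slice_continuous => x; exact: crho1.
have sr2 : continuous (rho2 i ^~ t) by apply: slice_continuous => x; exact: crho2.
have sv : continuous (v ^~ t) := slice cv.
have sv1 : continuous (v1 i ^~ t) := slice (@cv1 i).
have sv2 : continuous (v2 i ^~ t) := slice (@cv2 i).
apply: (@torus_integral_derive _ _ i (fun x => rho x t * v1 i x t - rho1 i x t * v x t)).
- by move=> x; apply: (@continuousB _ _ _ (fun x => rho x t * v1 i x t));
    apply: continuousM; [exact: sr|exact: sv1|exact: sr1|exact: sv].
- by move=> x; apply: (@continuousB _ _ _ (fun x => rho x t * v2 i x t));
    apply: continuousM; [exact: sr|exact: sv2|exact: sr2|exact: sv].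
- move=> x; have h1 := is_deriveM (drho1 i x t) (dv2 i x t).
  have h2 := is_deriveM (drho2 i x t) (dv1 i x t).
  have := is_deriveB h1 h2; rewrite (_ : _ - _ = rho x t * v2 i x t - rho2 i x t * v x t)//.
  by rewrite /GRing.scale /=; ring.
move=> x; rewrite pv pv1; congr (_ * _ - _ * _).
  by rewrite /rho addrAC kern_periodic.
by rewrite /rho1 addrAC kern1_periodic.
Qed.

Let L x t : R := rhot x t * v x t + rho x t * vt x t.
Let G x t : R := rho x t * v x t.

Let cL x t : t0 < t -> {for (x, t), continuous (fun z => L z.1 z.2)}.
Proof.
move=> t0t; apply: continuousD; apply: continuousM; [exact: crhot|exact: cv|exact: crho|exact: cvt].
Qed.

Let cG x t : t0 < t -> {for (x, t), continuous (fun z => G z.1 z.2)}.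
Proof. by move=> t0t; apply: continuousM; [exact: crho|exact: cv]. Qed.

Let dG x t : t0 < t -> is_derive t 1 (G x) (L x t).
Proof.
move=> t0t; have := is_deriveM (drhot x t0t) (dvt x t).
rewrite (_ : _ + _ = L x t)//.
by rewrite /L /GRing.scale /=; ring.
Qed.

(** Up to the Green terms, of zero integral, [L + rho * f] equals [(rhot - Lap rho) * v + rho * (vt
    + Lap v + f)]. The second term is nonnegative by the differential inequality, the first because
    [rho] is a supersolution and [v >= 0]. *)
Lemma duality_slice (f : 'rV[R]_n -> R) t : t0 < t -> continuous f ->
  (forall i x, v (x + unitv i) t = v x t) ->
  (forall i x, v1 i (x + unitv i) t = v1 i x t) ->
  (forall x : 'rV[R]_n, (forall i, 0 <= x 0 i < 1) -> 0 <= v x t) ->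
  (forall x, 0 <= vt x t + \sum_i v2 i x t + f x) ->
  - torus_integral (fun x => rho x t * f x) <= torus_integral (L ^~ t).
Proof.
move=> t0t cf pv pv1 v0 vf.
have sr : continuous (rho ^~ t) by apply: slice_continuous => x; exact: crho.
have sr2 i : continuous (rho2 i ^~ t) by apply: slice_continuous => x; exact: crho2.
have sL : continuous (L ^~ t) by apply: slice_continuous => x; exact: cL.
have sv : continuous (v ^~ t) := slice cv.
have sv2 i : continuous (v2 i ^~ t) := slice (@cv2 i).
have cg i : continuous (fun x => rho x t * v2 i x t - rho2 i x t * v x t).
  by move=> x; apply: (@continuousB _ _ _ (fun x => rho x t * v2 i x t));
    apply: continuousM; [exact: sr|exact: sv2|exact: sr2|exact: sv].
have crf : continuous (fun x => rho x t * f x).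
  by move=> x; exact: (continuousM (sr x) (cf x)).
have cgs : continuous (fun x => \sum_i (rho x t * v2 i x t - rho2 i x t * v x t)).
  by move=> x; apply: continuous_sum_at => i; exact: cg.
have S0 : torus_integral (fun x => \sum_i (rho x t * v2 i x t - rho2 i x t * v x t)) = 0.
  by rewrite torus_integral_sum// big1// => i _; rewrite kern_green.
have : 0 <= torus_integral (fun x => rho x t * f x +
    \sum_i (rho x t * v2 i x t - rho2 i x t * v x t) + L x t).
  apply: Rintegral_ge0 => y yc; set x := row_of y.
  have h1 := kern_supersolution (x - x0) (rtime t0t).
  have h2 : 0 <= (rhot x t - \sum_i rho2 i x t) * v x t by rewrite mulr_ge0 ?subr_ge0// v0.
  have h3 : 0 <= rho x t * (vt x t + \sum_i v2 i x t + f x) by rewrite mulr_ge0// ltW// kern_gt0.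
  rewrite sumrB -mulr_sumr -mulr_suml /L.
  by move: h2 h3; lra.
rewrite torus_integralD//; last first.
  by move=> x; apply: (@continuousD _ _ _ (fun x => rho x t * f x)); [exact: crf|exact: cgs].
by rewrite torus_integralD// S0; lra.
Qed.

(** A measurable majorant [Psi] stands in for the space integral of [rho * f], so [f] need only be
    continuous on each slice. The hypotheses leave out the time [beta], which will be the final time
    [T], where the equation is not assumed. *)
Lemma duality_bound (alpha beta : R) (f : 'rV[R]_n -> R -> R) (Psi : R -> R) :
  t0 < alpha < beta ->
  (forall t, alpha <= t < beta -> [/\ continuous (f ^~ t),
    forall i x, v (x + unitv i) t = v x t,
    forall i x, v1 i (x + unitv i) t = v1 i x t,
    forall x : 'rV[R]_n, (forall i, 0 <= x 0 i < 1) -> 0 <= v x t &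
    forall x, 0 <= vt x t + \sum_i v2 i x t + f x t]) ->
  measurable_fun (`[alpha, beta[%classic : set (measurableTypeR R)) Psi ->
  (forall t, 0 <= Psi t) ->
  (forall t, alpha <= t < beta -> torus_integral (fun x => rho x t * f x t) <= Psi t) ->
  ((torus_integral (fun x => rho x alpha * v x alpha))%:E <=
   (torus_integral (fun x => rho x beta * v x beta))%:E +
     \int[leb]_(t in `[alpha, beta[) (Psi t)%:E)%E.
Proof.
move=> /andP[t0a ab] vf mPsi Psi0 fPsi.
have t0t t : alpha <= t <= beta -> t0 < t by move=> /andP[at_ _]; exact: lt_le_trans at_.
have cL' x t : alpha <= t <= beta -> {for (x, t), continuous (fun z => L z.1 z.2)}.
  by move=> /t0t; exact: cL.
have dG' x t : alpha <= t <= beta -> is_derive t 1 (G x) (L x t).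
  by move=> /t0t; exact: dG.
have cGt t : alpha <= t <= beta -> continuous (G ^~ t).
  by move=> tab; apply: slice_continuous => x; apply: cG; exact: t0t.
have ca : continuous (G ^~ alpha) by apply: cGt; rewrite lexx ltW.
have cb : continuous (G ^~ beta) by apply: cGt; rewrite lexx ltW.
have E := cylinder_FTC ab cL' dG' ca cb.
have iL := integrable_torus_integral ab cL'.
have mI : measurable (`[alpha, beta[%classic : set (measurableTypeR R)) by exact: measurable_itv.
(* If the integral of [Psi] is infinite the bound is trivial; otherwise [Psi] is integrable and can
   be compared with [L]. *)
have [->|Psioo] := eqVneq (\int[leb]_(t in `[alpha, beta[) (Psi t)%:E)%E +oo%E.
  by rewrite addey// leey.
have iPsi : leb.-integrable `[alpha, beta[ (EFin \o Psi).
  apply/integrableP; split; first exact/measurable_EFinP.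
  under eq_integral do rewrite /= ger0_norm//.
  by rewrite ltey.
have : (\int[leb]_(t in `[alpha, beta[) (- Psi t)%:E <=
    \int[leb]_(t in `[alpha, beta[) (torus_integral (L ^~ t))%:E)%E.
  apply: le_integral => //.
    rewrite (_ : (fun t => _) = -%E \o (EFin \o Psi))//; exact: integrableN.
  move=> t; rewrite inE /= in_itv /= => tab; rewrite lee_fin.
  have [cf pv pv1 v0 vf'] := vf t tab.
  have t0t' : t0 < t by apply: t0t; move/andP: tab => [-> /ltW].
  by apply: le_trans (duality_slice t0t' cf pv pv1 v0 vf'); rewrite lerN2 fPsi.
rewrite E (_ : (\int[leb]_(t in _) (- Psi t)%:E =
  - \int[leb]_(t in `[alpha, beta[) (Psi t)%:E)%E); last first.
  by rewrite -integralN//; apply: integrable_add_def.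
have : (\int[leb]_(t in `[alpha, beta[) (Psi t)%:E)%E \is a fin_num.
  exact: (integrable_fin_num mI iPsi).
by case: (\int[leb]_(t in _) _)%E => // r _; rewrite -EFinN -EFinD !lee_fin; lra.
Qed.

End duality.

Lemma continuous_kern_slice {R : realType} {n : nat} (x0 : 'rV[R]_n) (r : R) : 0 < r ->
  continuous (fun x : 'rV[R]_n => kern (x - x0) r).
Proof.
move=> r0; have c y : {for (y, r), continuous (fun z : 'rV[R]_n * R => kern (z.1 - x0) (z.2 - 0))}.
  by apply: continuous_shift; apply: continuous_kern; rewrite subr0.
by have := slice_continuous (L := fun x t => kern (x - x0) (t - 0)) c; rewrite subr0.
Qed.

(** * Boundedness of the mass of the kernel *)

Section mass.
Context {R : realType} {n : nat}.
Variables (x0 : 'rV[R]_n) (t0 : R).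

Lemma parabolic_jet1 :
  parabolic_jet (fun _ _ => 1) (fun _ _ => 0) (fun _ _ _ => 0) (fun _ (_ : 'rV[R]_n) _ => 0 : R).
Proof.
split; try (by move=> *; exact: cst_continuous); by move=> *; exact: is_derive_cst.
Qed.

(* [duality_bound] for the constant function 1. *)
Lemma kern_mass_le (t T : R) : t0 < t <= T ->
  torus_integral (fun x => kern (x - x0) (t - t0)) <=
  torus_integral (fun x => kern (x - x0) (T - t0)).
Proof.
move=> /andP[t0t]; rewrite le_eqVlt => /predU1P[->//|tT].
have := @duality_bound _ _ x0 t0 _ _ _ _ parabolic_jet1 t T (fun _ _ => 0) (fun=> 0).
rewrite t0t tT => /(_ isT) H.
have E s : (fun x => kern (x - x0) (s - t0)) = (fun x => kern (x - x0) (s - t0) * 1).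
  by apply/funext => x; rewrite mulr1.
move: H; rewrite integral0 adde0 lee_fin => H; rewrite (E t) (E T); apply: H.
- move=> s _; split => // [|x]; first exact: cst_continuous.
  by rewrite big1// !addr0.
- exact: measurable_cst.
- by [].
move=> s _; under eq_fun do rewrite mulr0.
by rewrite torus_integral_cst.
Qed.

(** Here [T] is an age, not a date: the mass at age [t - t0] is at most the mass at age [T], where
    the sup bound [kern_le] is harmless since the cell has volume 1. The result stays uniform as the
    age tends to 0. *)
Lemma kern_mass_bound (t T : R) : t0 < t -> t - t0 <= T ->
  torus_integral (fun x => kern (x - x0) (t - t0)) <= expR (n%:R * (pi ^+ 2 * T - ln T / 2)).
Proof.
move=> t0t tT; have T0 : 0 < T by apply: lt_le_trans tT; rewrite subr_gt0.
have tTt : t0 < t <= t0 + T by rewrite t0t -lerBlDl.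
apply: (le_trans (kern_mass_le tTt)); rewrite addrAC subrr add0r.
rewrite -[leRHS](torus_integral_cst (n := n)); apply: le_torus_integral.
- exact: continuous_kern_slice.
- exact: cst_continuous.
- by move=> x _; exact: kern_le.
Qed.

End mass.

(** * Hoelder's inequality in space and time *)

Lemma measurable_restrict_setT d1 d2 (S : measurableType d1) (S' : measurableType d2)
    (D : set S) (f : S -> S') :
  measurable D -> measurable_fun setT f -> measurable_fun setT (f \_ D).
Proof.
by move=> mD mf; apply: (measurable_restrictT f mD).1; exact: measurable_funTS.
Qed.

Section space_norm.
Context {R : realType} {n : nat}.
Implicit Types f k : 'rV[R]_n -> R.

Lemma torus_normE (b : R) f : b != 0 ->
  torus_norm b%:E f = ((\int[@lebd R n]_(y in cell) (`|f (row_of y)| `^ b)%:E) `^ b^-1)%E.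
Proof.
move=> b0; rewrite /torus_norm unlock; congr (_ `^ _)%E.
rewrite [RHS]integral_mkcond; apply: eq_integral => y _.
by rewrite !patchE; case: ifP => _ //=; rewrite normr0 powR0.
Qed.

Lemma torus_norm_lty (b : R) f : 0 < b -> continuous f -> (torus_norm b%:E f < +oo)%E.
Proof.
move=> b0 cf; rewrite torus_normE ?gt_eqF//; apply: poweR_lty.
have cK : continuous (fun z : 'rV[R]_n * R => f z.1).
  by move=> z; apply: continuous_comp; [exact: cvg_fst|exact: cf].
have [M fM] := @continuous_cell_bounded _ _ (fun x _ => f x) 0 0 cK.
apply: (@le_lt_trans _ _ (\int[@lebd R n]_(y in cell) (`|M| `^ b)%:E)%E); last first.
  rewrite [X in (X < _)%E]integral_cst; last exact: measurable_cell.
  by rewrite [X in (_ * X < _)%E](@lebd_cell R n) mule1 ltry.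
apply: ge0_le_integral.
- exact: measurable_cell.
- by move=> y _; rewrite lee_fin powR_ge0.
- apply/measurable_EFinP; apply: (measurableT_comp (measurable_powR b)).
  apply: measurableT_comp => //; apply: measurable_funTS; exact: continuous_measurable_row.
- by apply/measurable_EFinP; exact: measurable_cst.
- move=> y yc; rewrite lee_fin ge0_ler_powR ?nnegrE ?(ltW b0)//.
  by rewrite (le_trans _ (ler_norm _))// (fM y 0)// lexx.
Qed.

(** Tonelli: joint continuity of [f] yields joint measurability of the integrand, hence
    measurability in time of the space integral. *)
Lemma measurable_torus_norm (b : R) (f : 'rV[R]_n -> R -> R) : b != 0 ->
  continuous (fun z : 'rV[R]_n * R => f z.1 z.2) ->
  measurable_fun [set: measurableTypeR R] (fun t => torus_norm b%:E (f ^~ t)).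
Proof.
move=> b0 cf.
pose h (z : measurableTypeR R * (n.-tuple (measurableTypeR R))) : \bar R :=
  (((fun z => (`|f (row_of z.2) z.1| `^ b)%:E) \_ (setT `*` cell)) z)%E.
have mh : measurable_fun setT h.
  have mX : measurable ([set: measurableTypeR R] `*` @cell R n).
    exact: measurableX measurableT (@measurable_cell R n).
  apply: measurable_restrict_setT => //.
  apply/measurable_EFinP; apply: (measurableT_comp (measurable_powR b)).
  by apply: measurableT_comp => //; exact: continuous_measurable_swap.
have h0 z : (0 <= h z)%E.
  by rewrite /h patchE; case: ifP => // _; rewrite lee_fin powR_ge0.
have := measurable_fun_fubini_tonelli_F (m2 := @lebd R n) h mh h0.
move=> mF.
rewrite (_ : (fun t => _) = fun t => (fubini_F (@lebd R n) h t `^ b^-1)%E).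
  exact: (measurableT_comp (measurable_poweR b^-1) mF).
apply/funext => t; rewrite torus_normE//; congr (_ `^ _)%E.
by rewrite /fubini_F restrict_setX_integral patchE in_setT.
Qed.

(** Interpolation between the sup norm and the mass, from the pointwise bound
    [k ^ b' <= A ^ (b' - 1) * k]. *)
Lemma torus_norm_le (b' A m : R) k : 1 < b' -> continuous k ->
  (forall x, 0 <= k x <= A) -> torus_integral k <= m ->
  (torus_norm b'%:E k <= (A `^ (1 - b'^-1) * m `^ b'^-1)%:E)%E.
Proof.
move=> b'1 ck kA km; have b'0 : 0 < b' by apply: lt_trans b'1.
have A0 : 0 <= A by have /andP[] := kA 0; exact: le_trans.
have m0 : 0 <= m.
  by apply: le_trans km; apply: Rintegral_ge0 => y _; have /andP[] := kA (row_of y).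
rewrite torus_normE ?gt_eqF//.
have -> : A `^ (1 - b'^-1) * m `^ b'^-1 = (A `^ (b' - 1) * m) `^ b'^-1.
  rewrite powRM ?powR_ge0// -powRrM; congr (_ `^ _ * _).
  by rewrite mulrBl mul1r mulfV// gt_eqF.
rewrite -poweR_EFin; apply: gt0_ler_poweR.
- by rewrite invr_ge0 ltW.
- by rewrite in_itv /= leey andbT integral_ge0// => y _; rewrite lee_fin powR_ge0.
- by rewrite in_itv /= leey andbT lee_fin mulr_ge0 ?powR_ge0.
apply: (@le_trans _ _ (\int[@lebd R n]_(y in cell) ((A `^ (b' - 1))%:E * (k (row_of y))%:E))%E).
  apply: ge0_le_integral.
  - exact: measurable_cell.
  - by move=> y _; rewrite lee_fin powR_ge0.
  - apply/measurable_EFinP; apply: (measurableT_comp (measurable_powR b')).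
    apply: measurableT_comp => //; apply: measurable_funTS; exact: continuous_measurable_row.
  - apply/measurable_EFinP; apply: measurable_funM => //.
    by apply: measurable_funTS; exact: continuous_measurable_row.
  - move=> y _; have /andP[k0 kAy] := kA (row_of y).
    rewrite -EFinM lee_fin ger0_norm//.
    move: k0; rewrite le_eqVlt => /predU1P[<-|k0].
      by rewrite powR0 ?mulr0// gt_eqF.
    have -> : k (row_of y) `^ b' = k (row_of y) `^ (b' - 1) * k (row_of y).
      rewrite -[X in _ = _ * X](powRr1 (ltW k0)) -powRD ?subrK//.
      by rewrite (gt_eqF k0) implybT.
    rewrite ler_pM2r//.
    by rewrite ge0_ler_powR ?nnegrE ?(ltW k0)// subr_ge0 ltW.
rewrite ge0_integralZl_EFin//; first last.
- by rewrite powR_ge0.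
- by apply/measurable_EFinP; apply: measurable_funTS; exact: continuous_measurable_row.
- by move=> y _; have /andP[] := kA (row_of y).
- exact: measurable_cell.
by rewrite -torus_integral_EFin// -EFinM lee_fin ler_wpM2l ?powR_ge0.
Qed.

Lemma torus_hoelder (b b' A m : R) k f : 1 < b -> b^-1 + b'^-1 = 1 ->
  continuous k -> continuous f ->
  (forall x, 0 <= k x <= A) -> torus_integral k <= m ->
  ((torus_integral (fun x => k x * f x))%:E <=
   (A `^ b^-1 * m `^ b'^-1)%:E * torus_norm b%:E f)%E.
Proof.
move=> b1 bb ck cf kA km; have b0 : 0 < b by apply: lt_trans b1.
have b'V : b'^-1 = 1 - b^-1 by rewrite -bb addrAC subrr add0r.
have b'1 : 1 < b'.
  have h : 0 < b'^-1 < 1 by rewrite b'V subr_gt0 invf_lt1// b1 gtrBl invr_gt0.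
  have b'0 : 0 < b' by rewrite -invr_gt0; case/andP: h.
  by rewrite -[b']invrK invf_gt1 ?invr_gt0//; case/andP: h.
have b'0 : 0 < b' by apply: lt_trans b'1.
pose k1 := (fun y : n.-tuple (measurableTypeR R) => k (row_of y)) \_ cell.
pose f1 := (fun y : n.-tuple (measurableTypeR R) => f (row_of y)) \_ cell.
have mr (g : 'rV[R]_n -> R) : continuous g ->
    measurable_fun setT ((fun y : n.-tuple (measurableTypeR R) => g (row_of y)) \_ cell).
  move=> cg; apply: measurable_restrict_setT; first exact: measurable_cell.
  exact: continuous_measurable_row.
have H := @hoelder _ _ _ (@lebd R n) k1 f1 b' b (mr k ck) (mr f cf) b'0 b0.
rewrite addrC bb in H.
have EE c (g : 'rV[R]_n -> R) :
    ('N[@lebd R n]_c[EFin \o ((fun y : n.-tuple (measurableTypeR R) => g (row_of y)) \_ cell)] =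
    torus_norm c g)%E by rewrite /torus_norm -restrict_EFin.
have ckf : continuous (fun x => k x * f x) by move=> x; exact: (continuousM (ck x) (cf x)).
apply: (@le_trans _ _ ('N[@lebd R n]_1[EFin \o (k1 \* f1)%R])%E).
  rewrite Lnorm1 torus_integral_EFin// [X in (X <= _)%E]integral_mkcond.
  apply: (le_trans (lee_abs _)); apply: le_trans (le_abse_integral _ _ _) _ => //.
    have := mr _ ckf => /measurable_EFinP; by rewrite restrict_EFin.
  rewrite le_eqVlt; apply/orP; left; apply/eqP; apply: eq_integral => y _.
  rewrite /= /k1 /f1 !patchE; case: ifP => //= _; by rewrite mul0r.
apply: (le_trans (H erefl)); rewrite !EE.
apply: lee_wpmul2r; first exact: Lnorm_ge0.
have -> : b^-1 = 1 - b'^-1 by rewrite b'V opprB addrC subrK.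
exact: torus_norm_le.
Qed.

End space_norm.

Section time_norm.
Context {R : realType}.

(** Starting at [alpha > t0] avoids the singularity, while the bound involves neither [t0] nor
    [alpha]: later [alpha] depends on a tolerance that is made arbitrarily small. *)
Lemma integral_power_le (t0 alpha T theta : R) : 0 <= t0 -> t0 < alpha -> alpha < T ->
  theta < 1 ->
  (\int[leb]_(t in `[alpha, T[) ((t - t0) `^ (- theta))%:E <= (T `^ (1 - theta) / (1 - theta))%:E)%E.
Proof.
move=> t00 t0a aT th1.
have th0 : 0 < 1 - theta by rewrite subr_gt0.
have dF t : t0 < t ->
    is_derive t 1 (fun t : R => (1 - theta)^-1 * (t - t0) `^ (1 - theta)) ((t - t0) `^ (- theta)).
  move=> t0t; have dp := is_derive1_powR (1 - theta) (_ : 0 < t - t0).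
  rewrite subr_gt0 in dp; have {}dp := dp t0t.
  have ds : is_derive t 1 (fun t : R => t - t0) 1.
    apply: is_derive_eq; by rewrite subr0.
  have dc := @is_derive1_comp _ (@powR R ^~ (1 - theta)) (fun t => t - t0) t _ _ dp ds.
  have := is_deriveM (is_derive_cst (1 - theta)^-1 t 1) dc.
  rewrite (_ : _ *: _ + _ = (t - t0) `^ (- theta))//.
  rewrite /GRing.scale /= mulr0 addr0 mulr1 mulrA mulVf ?gt_eqF// mul1r.
  by congr (_ `^ _); rewrite addrAC subrr add0r.
have cg t : t0 < t -> {for t, continuous (fun t : R => (t - t0) `^ (- theta))}.
  move=> t0t; have := is_derive1_powR (- theta) (_ : 0 < t - t0).
  rewrite subr_gt0 => /(_ t0t) dp.
  have ds : is_derive t 1 (fun t : R => t - t0) 1.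
    apply: is_derive_eq; by rewrite subr0.
  have [dd _] := @is_derive1_comp _ (@powR R ^~ (- theta)) (fun t => t - t0) t _ _ dp ds.
  exact/differentiable_continuous/derivable1_diffP.
have mg : measurable_fun [set: measurableTypeR R] (fun t : R => (t - t0) `^ (- theta)).
  apply: (measurableT_comp (measurable_powR (- theta))).
  exact: measurable_funB.
rewrite [X in (X <= _)%E]integral_itv_bndo_bndc; last first.
  by apply: measurable_funTS; exact/measurable_EFinP.
rewrite (@continuous_FTC2 _ _ (fun t : R => (1 - theta)^-1 * (t - t0) `^ (1 - theta)))//.
- rewrite -EFinB lee_fin -mulrBr mulrC ler_pM2r ?invr_gt0//.
  rewrite lerBlDr (le_trans (y := T `^ (1 - theta)))//.
    rewrite ge0_ler_powR ?nnegrE ?(ltW th0)//; first by rewrite subr_ge0 ltW// (lt_trans t0a).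
      by rewrite ltW// (le_lt_trans t00)// (lt_trans t0a).
    by rewrite gerBl.
  by rewrite lerDl powR_ge0.
- apply: continuous_in_subspaceT => t; rewrite inE /= in_itv /= => /andP[at_ _].
  by apply: cg; exact: lt_le_trans at_.
- split.
  + move=> t; rewrite in_itv /= => /andP[at_ _].
    by have [] := dF t (lt_trans t0a at_).
  + apply: cvg_at_right_filter; have [d _] := dF _ t0a.
    exact: (differentiable_continuous ((derivable1_diffP _ _).1 d)).
  + apply: cvg_at_left_filter; have [d _] := dF _ (lt_trans t0a aT).
    exact: (differentiable_continuous ((derivable1_diffP _ _).1 d)).
move=> t; rewrite in_itv /= => /andP[at_ _].
by rewrite derive1E; apply: derive_val; apply: dF; exact: lt_trans at_.
Qed.

Lemma time_hoelder (a a' s t0 alpha T : R) (F : R -> R) :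
  0 < a -> 0 < a' -> a^-1 + a'^-1 = 1 -> s * a' < 1 ->
  0 <= t0 -> t0 < alpha -> alpha < T ->
  measurable_fun [set: measurableTypeR R] F -> (forall t, 0 <= F t) ->
  (\int[leb]_(t in `[alpha, T[) ((t - t0) `^ (- s) * F t)%:E <=
   ((T `^ (1 - s * a') / (1 - s * a')) `^ a'^-1)%:E *
   'N[leb]_a%:E[(EFin \o F) \_ `]0%R, T[%classic])%E.
Proof.
move=> a0 a'0 aa th1 t00 t0a aT mF F0.
pose g (t : measurableTypeR R) : R := (t - t0) `^ (- s).
have mg : measurable_fun [set: measurableTypeR R] g.
  apply: (measurableT_comp (measurable_powR (- s))).
  exact: measurable_funB.
have mI : measurable (`[alpha, T[%classic : set (measurableTypeR R)) by exact: measurable_itv.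
have mJ : measurable (`]0, T[%classic : set (measurableTypeR R)) by exact: measurable_itv.
pose g1 := g \_ (`[alpha, T[%classic : set (measurableTypeR R)).
pose F1 := (F : measurableTypeR R -> R) \_ (`]0, T[%classic : set (measurableTypeR R)).
have mg1 : measurable_fun setT g1.
  exact: measurable_restrict_setT.
have mF1 : measurable_fun setT F1.
  exact: measurable_restrict_setT.
have H := @hoelder _ _ _ leb g1 F1 a' a mg1 mF1 a'0 a0.
rewrite addrC aa in H.
apply: (@le_trans _ _ ('N[leb]_1[EFin \o (g1 \* F1)%R])%E).
  rewrite Lnorm1 [X in (X <= _)%E]integral_mkcond le_eqVlt; apply/orP; left; apply/eqP.
  apply: eq_integral => t _; rewrite /= /g1 /F1 !patchE.
  case: ifPn => [|_]; last by rewrite mul0r normr0.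
  rewrite inE /= in_itv /= => /andP[at_ tT]; rewrite ifT.
    by rewrite ger0_norm// mulr_ge0// powR_ge0.
  by rewrite inE /= in_itv /= tT andbT (le_lt_trans t00)// (lt_le_trans t0a).
apply: (le_trans (H erefl)); rewrite [X in (_ * X <= _)%E](_ : _ =
  'N[leb]_a%:E[(EFin \o F) \_ `]0%R, T[%classic])%E; last by rewrite restrict_EFin.
apply: lee_wpmul2r; first exact: Lnorm_ge0.
rewrite unlock -poweR_EFin; apply: gt0_ler_poweR.
- by rewrite invr_ge0 ltW.
- rewrite in_itv /= leey andbT integral_ge0// => t _; exact: poweR_ge0.
- rewrite in_itv /= leey andbT lee_fin divr_ge0 ?powR_ge0// subr_ge0; exact: ltW.
apply: le_trans (integral_power_le t00 t0a aT th1).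
rewrite [X in (_ <= X)%E]integral_mkcond le_eqVlt; apply/orP; left; apply/eqP.
apply: eq_integral => t _; rewrite /= /g1 !patchE.
case: ifP => _; last by rewrite normr0 powR0// gt_eqF.
by rewrite ger0_norm ?powR_ge0// /g -powRrM mulNr.
Qed.

End time_norm.

(** * The upper bound *)

Section pointwise_bound.
Context {R : realType} {n : nat}.

(* On the cube with lower corner [x0] and side [sqrt (alpha - t0)] the kernel
   is comparable to the inverse volume of the cube. *)
Lemma kern_concentration (v : 'rV[R]_n -> R -> R) (x0 : 'rV[R]_n) (t0 T e : R) :
  continuous (fun z : 'rV[R]_n * R => v z.1 z.2) ->
  (forall i, 0 <= x0 0 i < 1) -> t0 < T ->
  (forall (x : 'rV[R]_n) t, (forall i, 0 <= x 0 i < 1) -> t0 <= t < T -> 0 <= v x t) -> 0 < e ->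
  exists2 alpha, t0 < alpha < T &
    expR (- (n%:R / 4)) * (v x0 t0 - e) <=
    torus_integral (fun x => kern (x - x0) (alpha - t0) * v x alpha).
Proof.
move=> cv x0c t0T v0 e0.
have : \forall z \near (x0, t0), v x0 t0 - e <= v z.1 z.2.
  have /cvgrPdist_le/(_ e e0) := cv (x0, t0).
  by apply: filterS => z /= /ler_normlP[]; lra.
move=> [[A B]] /= [/nbhs_ballP[r1 /= r10 rA] /nbhs_ballP[r2 /= r20 rB]] AB.
(* [h] is the side of the cube and [h ^+ 2] the age of the kernel. The bound [h < 1] makes the age
   smaller than [h], so [hr2] and [hT] control it too; [hx] keeps the cube inside the cell, with
   room on the right because every coordinate of [x0] is strictly below 1. *)
have [h [h0 h1 hr1 hr2 [hT hx]]] : exists h : R, [/\ 0 < h, h < 1, h < r1, h < r2 &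
    h < T - t0 /\ forall i, h <= 1 - x0 0 i].
  near (0 : R)^'+ => h; exists h; split => //; last split;
    try by near: h; apply: nbhs_right_lt; rewrite ?subr_gt0.
  near: h; apply: filter_forall => i; near=> h.
  by apply: ltW; near: h; apply: nbhs_right_lt; rewrite subr_gt0; have /andP[] := x0c i.
have hh : h ^+ 2 <= h by rewrite expr2 ler_piMl ?ltW.
have h20 : 0 < h ^+ 2 by rewrite exprn_gt0.
exists (t0 + h ^+ 2); first by rewrite ltrDl h20 -ltrBrDl (le_lt_trans hh).
rewrite addrAC subrr add0r.
(* Truncation at 0 allows multiplying lower bounds even when [v x0 t0 < e]. *)
pose c := Num.max 0 (v x0 t0 - e).
have c0 : 0 <= c by rewrite /c le_max lexx.
apply: (@le_trans _ _ (expR (- (n%:R / 4)) * c)).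
  by rewrite ler_pM2l ?expR_gt0// /c le_max lexx orbT.
pose alpha := t0 + h ^+ 2.
have vt0 (x : 'rV[R]_n) : (forall i, 0 <= x 0 i < 1) -> 0 <= v x alpha.
  by move=> xc; apply: v0 => //; rewrite lerDl (ltW h20) /= -ltrBrDl (le_lt_trans hh).
have ckv : continuous (fun x : 'rV[R]_n => kern (x - x0) (h ^+ 2) * v x alpha).
  have cva : continuous (v ^~ alpha).
    by apply: (slice_continuous (L := v)) => y; exact: cv.
  exact: continuous_mul (continuous_kern_slice h20) cva.
pose D := @box R n x0 (x0 + const_mx h).
have Dc : D `<=` cell.
  move=> y yD i; have /andP[y1 y2] := yD i; have /andP[x1 x2] := x0c i.
  rewrite (le_trans x1 y1)/= (lt_le_trans y2)// !mxE -lerBrDl.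
  exact: hx.
have mD : measurable D by exact: measurable_box.
have muD : @lebd R n D = (h ^+ n)%:E.
  rewrite [LHS]lebd_box => [|i]; last by rewrite !mxE lerDl ltW.
  congr (_%:E); under eq_bigr => i _ do rewrite !mxE addrAC subrr add0r.
  by rewrite prodr_const card_ord.
have kvD y : D y -> expR (- (n%:R / 4)) * c / h ^+ n <=
    kern (row_of y - x0) (h ^+ 2) * v (row_of y) alpha.
  move=> yD; have ylt i : `|row_of y 0 i - x0 0 i| <= h.
    have /andP[y1 y2] := yD i; move: y2; rewrite [X in _ < X]mxE [X in _ + X]mxE => y2.
    by rewrite ger0_norm ?subr_ge0// lerBlDl ltW.
  have hn : 0 < h ^+ n by rewrite exprn_gt0.
  have k1 : expR (- (n%:R / 4)) <= kern (row_of y - x0) (h ^+ 2) * h ^+ n.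
    have := @kern_ge R n (row_of y - x0) (h ^+ 2) h20.
    rewrite sqrtr_sqr (gtr0_norm h0); apply => i.
    rewrite -[leLHS]real_normK ?num_real// ler_sqr ?nnegrE ?(ltW h0)//.
    by have := ylt i; rewrite !mxE.
  have k2 : c <= v (row_of y) alpha.
    rewrite /c ge_max vt0 /=; last exact: Dc yD.
    apply: (AB (row_of y, alpha)); split.
      apply: rA; rewrite -ball_normE /= distrC (le_lt_trans _ hr1)//.
      by apply: row_norm_le => [|i]; rewrite ?(ltW h0)//; have := ylt i; rewrite !mxE.
    apply: rB; rewrite -ball_normE /= distrC /alpha addrAC subrr add0r.
    by rewrite gtr0_norm// (le_lt_trans hh).
  rewrite ler_pdivrMr// mulrAC; apply: ler_pM => //; exact: expR_ge0.
rewrite -lee_fin torus_integral_EFin//.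
apply: (@le_trans _ _ (\int[@lebd R n]_(y in D) (expR (- (n%:R / 4)) * c / h ^+ n)%:E)%E).
  rewrite [X in (_ <= X)%E]integral_cst// [X in (_ <= _ * X)%E]muD -EFinM divfK//.
  by rewrite gt_eqF// exprn_gt0.
apply: (@le_trans _ _ (\int[@lebd R n]_(y in D) (kern (row_of y - x0) (h ^+ 2) * v (row_of y) alpha)%:E)%E).
  apply: ge0_le_integral => //.
  - by move=> y _; rewrite lee_fin divr_ge0 ?exprn_ge0 ?(ltW h0)// mulr_ge0 ?expR_ge0.
  - apply/measurable_EFinP; apply: measurable_funTS; exact: continuous_measurable_row ckv.
apply: ge0_subset_integral => //.
- exact: measurable_cell.
- apply/measurable_EFinP; apply: measurable_funTS; exact: continuous_measurable_row ckv.
- by move=> y yc; rewrite lee_fin mulr_ge0 ?vt0// ltW// kern_gt0.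
Unshelve. all: by end_near. Qed.

(** Both constants are fixed before [v], [f] and [M], which is where independence of [eps] comes
    from. Their factor [expR (n / 4)] undoes the loss in [kern_concentration]. *)
Lemma subsolution_bound (T a b : R) : 0 < T -> 1 < a -> 1 < b ->
  n%:R / 2 < b * (a - 1) / a ->
  exists C1 C2 : R, [/\ 0 < C1, 0 < C2 &
  forall (v vt : 'rV[R]_n -> R -> R) (v1 v2 : 'I_n -> 'rV[R]_n -> R -> R)
    (f : 'rV[R]_n -> R -> R) (M : R) (x0 : 'rV[R]_n) (t0 : R),
  parabolic_jet v vt v1 v2 ->
  continuous (fun z : 'rV[R]_n * R => f z.1 z.2) ->
  (forall i (x : 'rV[R]_n) t, 0 < t < T -> v (x + unitv i) t = v x t) ->
  (forall i (x : 'rV[R]_n) t, 0 < t < T -> v1 i (x + unitv i) t = v1 i x t) ->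
  (forall (x : 'rV[R]_n) t, (forall i, 0 <= x 0 i < 1) -> 0 < t < T -> 0 <= v x t) ->
  (forall x t, 0 < t < T -> 0 <= vt x t + \sum_i v2 i x t + f x t) ->
  (forall x : 'rV[R]_n, (forall i, 0 <= x 0 i < 1) -> v x T <= M) -> 0 <= M ->
  (forall i, 0 <= x0 0 i < 1) -> 0 < t0 < T ->
  ((v x0 t0)%:E <= (C1 * M)%:E + C2%:E * mixed_norm T a%:E b%:E f)%E].
Proof.
move=> T0 a1 b1 hab.
have a0 : 0 < a by apply: lt_trans a1.
have b0 : 0 < b by apply: lt_trans b1.
pose a' := a / (a - 1); pose b' := b / (b - 1).
have a'0 : 0 < a' by rewrite divr_gt0// subr_gt0.
have b'0 : 0 < b' by rewrite divr_gt0// subr_gt0.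
have aa : a^-1 + a'^-1 = 1 by rewrite /a' invf_div; field; rewrite gt_eqF.
have bb : b^-1 + b'^-1 = 1 by rewrite /b' invf_div; field; rewrite gt_eqF.
pose s := n%:R / (2 * b).
have th1 : s * a' < 1.
  rewrite /s /a' mulrA ltr_pdivrMr ?subr_gt0// mul1r.
  move: hab; rewrite ltr_pdivlMr// => hab.
  rewrite mulrAC ltr_pdivrMr ?mulr_gt0//; move: hab; rewrite mulrAC ltr_pdivrMr//; lra.
(* With [r] the age: [m] bounds the mass of the kernel, [K * r ^ (- s)] its [L^b'] norm in space,
   and [Kt] the [L^a'] norm in time of [r ^ (- s)]. *)
pose m := expR (n%:R * (pi ^+ 2 * T - ln T / 2)) : R.
have m0 : 0 < m by exact: expR_gt0.
pose K := expR (n%:R * (pi ^+ 2 * T) / b) * m `^ b'^-1 : R.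
have K0 : 0 < K by rewrite mulr_gt0 ?expR_gt0 ?powR_gt0.
pose Kt := (T `^ (1 - s * a') / (1 - s * a')) `^ a'^-1 : R.
have Kt0 : 0 < Kt by rewrite powR_gt0// divr_gt0 ?powR_gt0// subr_gt0.
have C20 : 0 < expR (n%:R / 4) * (K * Kt) by apply: mulr_gt0; [exact: expR_gt0|exact: mulr_gt0].
exists (expR (n%:R / 4) * m), (expR (n%:R / 4) * (K * Kt)).
split; [by rewrite mulr_gt0 ?expR_gt0|exact: C20|].
move=> v vt v1 v2 f M x0 t0 jet cf pv pv1 v0 vf vM M0 x0c /andP[t00 t0T].
have cft t : continuous (f ^~ t) by apply: slice_continuous => x; exact: cf.
pose F t := fine (torus_norm b%:E (f ^~ t)).
have FE t : (F t)%:E = torus_norm b%:E (f ^~ t).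
  by rewrite fineK// ge0_fin_numE ?torus_norm_lty// Lnorm_ge0.
have F0 t : 0 <= F t by rewrite fine_ge0// Lnorm_ge0.
have mF : measurable_fun [set: measurableTypeR R] F.
  apply/measurable_EFinP; rewrite (_ : _ \o _ = fun t => torus_norm b%:E (f ^~ t)).
    by apply: measurable_torus_norm => //; rewrite gt_eqF.
  by apply/funext => t; exact: FE.
have NE : mixed_norm T a%:E b%:E f = ('N[leb]_a%:E[(EFin \o F) \_ `]0%R, T[%classic])%E.
  rewrite /mixed_norm; congr (Lnorm _ _ (_ \_ _)); apply/funext => t; exact/esym/FE.
rewrite NE; set N := ('N[leb]_a%:E[_])%E.
have N0 : (0 <= N)%E by exact: Lnorm_ge0.
have [Noo|Nfin] := eqVneq N +oo%E.
  by rewrite Noo gt0_muley ?lte_fin// addey// leey.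
have Nf : N \is a fin_num by rewrite ge0_fin_numE// ltey.
rewrite -(fineK Nf) -EFinM -EFinD lee_fin.
apply/ler_addgt0Pr => e e0.
(* The sup bound of the kernel enters Hoelder's inequality to the power [1 / b]: this turns
   [r ^ (- n / 2)] into [r ^ (- s)], and the growth factor is estimated by its value at [r = T]. *)
have Ab r : 0 < r -> r <= T -> expR (n%:R * (pi ^+ 2 * r - ln r / 2)) `^ b^-1 <=
    expR (n%:R * (pi ^+ 2 * T) / b) * r `^ (- s).
  move=> r0 rT; rewrite -expRM /powR gt_eqF// -expRD ler_expR.
  have -> : n%:R * (pi ^+ 2 * r - ln r / 2) / b = n%:R * (pi ^+ 2 * r) / b + - s * ln r.
    by rewrite /s; field; rewrite gt_eqF.
  by rewrite lerD2r ler_pM2r ?invr_gt0// ler_wpM2l// ler_wpM2l// sqr_ge0.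
have v0' (x : 'rV[R]_n) t : (forall i, 0 <= x 0 i < 1) -> t0 <= t < T -> 0 <= v x t.
  by move=> xc /andP[tt tT]; apply: v0; rewrite ?(lt_le_trans t00 tt).
have [alpha /andP[t0al alT] conc] := kern_concentration (jet_continuous jet) x0c t0T v0' e0.
pose Psi t := K * ((t - t0) `^ (- s) * F t).
have mg : measurable_fun [set: measurableTypeR R] (fun t : R => (t - t0) `^ (- s)).
  apply: (measurableT_comp (measurable_powR (- s))).
  exact: measurable_funB.
have := @duality_bound R n x0 t0 v vt v1 v2 jet alpha T f Psi.
rewrite t0al alT => /(_ isT) H.
have kslice t : t0 < t -> continuous (fun x : 'rV[R]_n => kern (x - x0) (t - t0)).
  by move=> t0t; apply: continuous_kern_slice; rewrite subr_gt0.
have {}H : ((torus_integral (fun x => kern (x - x0) (alpha - t0) * v x alpha))%:E <=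
   (torus_integral (fun x => kern (x - x0) (T - t0) * v x T))%:E +
     \int[leb]_(t in `[alpha, T[) (Psi t)%:E)%E.
  apply: H.
  - move=> t /andP[alt tT]; have t0t := lt_le_trans t0al alt.
    have tp := lt_trans t00 t0t.
    have tpT : 0 < t < T by rewrite tp.
    by split => // [i x|i x|x xc|x]; [exact: pv|exact: pv1|exact: v0|exact: vf].
  - apply: measurable_funTS; apply: measurable_funM => //.
    exact: measurable_funM.
  - by move=> t; rewrite mulr_ge0 ?(ltW K0)// mulr_ge0 ?powR_ge0.
  - move=> t /andP[alt tT]; have t0t := lt_le_trans t0al alt.
    have r0 : 0 < t - t0 by rewrite subr_gt0.
    have rT : t - t0 <= T by lra.
    have := @torus_hoelder R n b b' (expR (n%:R * (pi ^+ 2 * (t - t0) - ln (t - t0) / 2))) m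
      (fun x => kern (x - x0) (t - t0)) (f ^~ t) b1 bb (kslice t t0t) (cft t).
    have kA x : 0 <= kern (x - x0) (t - t0) <= expR (n%:R * (pi ^+ 2 * (t - t0) - ln (t - t0) / 2)).
      by rewrite ltW ?kern_gt0//= kern_le.
    move=> /(_ kA)/(_ (kern_mass_bound _ t0t rT)).
    rewrite -FE -EFinM lee_fin => /le_trans; apply.
    rewrite /Psi mulrA ler_wpM2r// /K.
    rewrite [leRHS]mulrAC ler_pM2r ?powR_gt0//.
    exact: Ab.
have HM : torus_integral (fun x => kern (x - x0) (T - t0) * v x T) <= M * m.
  have ck := kslice T t0T.
  apply: (@le_trans _ _ (torus_integral (fun x => M * kern (x - x0) (T - t0)))).
    apply: le_torus_integral.
    - have cvT : continuous (v ^~ T).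
        by apply: (slice_continuous (L := v)) => y; exact: jet_continuous jet _.
      exact: continuous_mul ck cvT.
    - apply: continuous_mul ck; exact: cst_continuous.
    - by move=> x xc; rewrite mulrC ler_wpM2r ?vM// ltW// kern_gt0.
  rewrite [leLHS](RintegralZl M (@measurable_cell R n) (continuous_cell_integrable ck)).
  rewrite ler_wpM2l//; apply: kern_mass_bound => //; lra.
have HP : (\int[leb]_(t in `[alpha, T[) (Psi t)%:E <= K%:E * (Kt%:E * N))%E.
  rewrite /Psi; under eq_integral do rewrite EFinM.
  rewrite ge0_integralZl_EFin//.
  - apply: lee_wpmul2l; first by rewrite lee_fin ltW.
    exact: time_hoelder (ltW t00) t0al alT mF F0.
  - by move=> t _; rewrite lee_fin mulr_ge0 ?powR_ge0.
  - apply/measurable_EFinP; apply: measurable_funTS; exact: measurable_funM.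
  - exact: ltW.
have : expR (- (n%:R / 4)) * (v x0 t0 - e) <= M * m + K * (Kt * fine N).
  rewrite -lee_fin (le_trans _ (le_trans H _))//.
  by rewrite EFinD; apply: leeD => //; rewrite !EFinM (fineK Nf).
have E : expR (n%:R / 4) * expR (- (n%:R / 4)) = 1 :> R.
  by rewrite -expRD subrr expR0.
move=> /(ler_wpM2l (expR_ge0 (n%:R / 4))); rewrite [leLHS]mulrA E mul1r => h.
by rewrite -lerBlDr (le_trans h)// le_eqVlt; apply/orP; left; apply/eqP; ring.
Qed.

End pointwise_bound.

(** * The minimum principle *)

Section derivative_at_minimum.
Context {R : realType}.

Lemma is_derive_lt0_right (g : R -> R) (s l : R) : is_derive s 1 g l -> l < 0 ->
  exists2 d, 0 < d & forall h, 0 < h < d -> g (s + h) < g s.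
Proof.
move=> [dg gl] l0.
have : h^-1 *: (g (h *: 1 + s) - g s) @[h --> 0^'] --> l by rewrite -gl; exact: dg.
move=> /cvgrPdist_lt/(_ (- l)); rewrite oppr_gt0 => /(_ l0).
move=> /nbhs_ballP[d /= d0 dh]; exists d => // h /andP[h0 hd].
have : ball 0 d h by rewrite -ball_normE /= sub0r normrN gtr0_norm.
move=> /dh /(_ (lt0r_neq0 h0)); rewrite /= /GRing.scale /= mulr1 [h + s]addrC.
move=> /ltr_normlP[]; set q := h^-1 * _ => h1 h2.
have : q < 0 by lra.
by rewrite /q pmulr_rlt0 ?invr_gt0// subr_lt0.
Qed.

Lemma is_derive_right_min (g : R -> R) (s l d : R) : is_derive s 1 g l -> 0 < d ->
  (forall h, 0 < h < d -> g s <= g (s + h)) -> 0 <= l.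
Proof.
move=> dg d0 gmin; rewrite leNgt; apply/negP => l0.
have [e e0 ge] := is_derive_lt0_right dg l0.
pose h := Num.min d e / 2.
have m0 : 0 < Num.min d e by rewrite lt_min d0 e0.
have h0 : 0 < h by rewrite divr_gt0.
have hm : h < Num.min d e by rewrite /h; lra.
move: hm; rewrite lt_min => /andP[hd he].
have := lt_le_trans (ge h _) (gmin h _).
by rewrite h0 hd he ltxx => /(_ isT isT).
Qed.

(** Were [l] negative, [g1] would be negative just to the right of 0, and the mean value theorem
    would give a value of [g] below [g 0]. *)
Lemma second_derivative_min (g g1 : R -> R) (l : R) :
  (forall h : R, is_derive h 1 g (g1 h)) -> is_derive (0 : R) 1 g1 l ->
  (forall h, -1 < h < 1 -> g 0 <= g h) -> g1 0 = 0 /\ 0 <= l.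
Proof.
move=> dg dg1 gmin.
have g10 : g1 0 = 0.
  have [] : is_derive (0 : R) 1 g 0.
    apply: (@derive1_at_min R g (-1) 1 0).
    - by rewrite (le_trans (lerN10 _)).
    - by move=> h _; have [] := dg h.
    - by rewrite in_itv /= ltrN10 ltr01.
    - by move=> h; rewrite in_itv /=; exact: gmin.
  by move=> _ E; have [_ E'] := dg 0; rewrite -E' E.
split => //; rewrite leNgt; apply/negP => l0.
have [e e0 ge] := is_derive_lt0_right dg1 l0.
pose h := Num.min 1 e / 2.
have m0 : 0 < Num.min 1 e by rewrite lt_min ltr01 e0.
have h0 : 0 < h by rewrite divr_gt0.
have hm : h < Num.min 1 e by rewrite /h; lra.
move: hm; rewrite lt_min => /andP[h1 he].
have [|c] := @MVT R g g1 0 h h0.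
  by apply: derivable_within_continuous => x _; have [] := dg x.
rewrite in_itv /= => /andP[c0 ch]; rewrite subr0 => E.
have : g1 (0 + c) < g1 0 by apply: ge; rewrite c0 (lt_trans ch).
rewrite add0r g10 => gc; have : g h - g 0 < 0 by rewrite E pmulr_llt0.
by rewrite subr_lt0 ltNge gmin// h1 andbT (lt_trans _ h0)// ltrN10.
Qed.

End derivative_at_minimum.

Section minimum_principle.
Context {R : realType} {n : nat}.

(** A minimum over the closed cube may lie on a face. A displacement shorter than 1 along an axis
    leaves the cube by less than one period, so one shift brings the point back and the minimum
    behaves like an interior one. *)
Lemma cube_min_periodic (f : 'rV[R]_n -> R) (x : 'rV[R]_n) i (h : R) :
  (forall y, f (y + unitv i) = f y) ->
  (forall j, 0 <= x 0 j <= 1) ->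
  (forall y : 'rV[R]_n, (forall j, 0 <= y 0 j <= 1) -> f x <= f y) ->
  -1 < h < 1 -> f x <= f (h *: unitv i + x).
Proof.
move=> fp xc fmin /andP[hN1 h1].
have E (c : R) j : (h *: unitv i + x + c *: unitv i) 0 j = if j == i then h + x 0 i + c else x 0 j.
  by rewrite !mxE eqxx /=; case: eqP => [->|_]; rewrite ?mulr1// !mulr0 add0r addr0.
have /andP[x0 x1] := xc i.
have ok c : 0 <= h + x 0 i + c <= 1 -> f x <= f (h *: unitv i + x + c *: unitv i).
  by move=> hc; apply: fmin => j; rewrite E; case: eqP => // _; exact: xc.
have [hx0|hx0] := ltP (h + x 0 i) 0.
  by have := fp (h *: unitv i + x) => <-; rewrite -[X in f (_ + X)]scale1r; apply: ok; lra.
have [hx1|hx1] := leP (h + x 0 i) 1.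
  by rewrite -[_ + x]addr0 -(scale0r (unitv i)); apply: ok; rewrite addr0 hx0 hx1.
rewrite -[X in _ <= f X](subrK (unitv i)) fp -scaleN1r; apply: ok; lra.
Qed.

(* [C > C0] excludes an interior minimum of [u + C * (T - t)]. *)
Lemma minimum_principle (T C0 M C : R) (u ut : 'rV[R]_n -> R -> R)
    (u1 u2 : 'I_n -> 'rV[R]_n -> R -> R) :
  parabolic_jet u ut u1 u2 -> C0 < C ->
  (forall i (x : 'rV[R]_n) t, 0 < t < T -> u (x + unitv i) t = u x t) ->
  (forall x t, 0 < t < T -> (forall i, u1 i x t = 0) ->
     ut x t + \sum_i u2 i x t <= C0) ->
  (forall x : 'rV[R]_n, (forall i, 0 <= x 0 i <= 1) -> M <= u x T) ->
  forall (x : 'rV[R]_n) t, (forall i, 0 <= x 0 i <= 1) -> 0 < t < T ->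
    M - C * (T - t) <= u x t.
Proof.
move=> jet CC pu pde uM x0 t0 x0c /andP[t00 t0T].
pose W (z : 'rV[R]_n * R) := u z.1 z.2 + C * (T - z.2).
pose A : set ('rV[R]_n * R) :=
  [set v : 'rV[R]_n | forall i, `[(0:R), 1]%classic (v ord0 i)] `*` `[t0, T]%classic.
have cA : compact A.
  apply: compact_setX; last exact: segment_compact.
  by apply: (@rV_compact _ _ (fun=> `[(0:R), 1]%classic)) => i; exact: segment_compact.
have inA (x : 'rV[R]_n) t : (forall i, 0 <= x 0 i <= 1) -> t0 <= t <= T -> (x, t) \in A.
  move=> xc tT; rewrite inE; split => [i|] /=; last by rewrite in_itv.
  by rewrite /= in_itv /=; exact: xc.
have [||[x s] zA zmin] := @compact_EVT_min _ R W A _ cA.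
- exists (x0, t0); apply/set_mem/inA => //; by rewrite lexx ltW.
- apply: continuous_subspaceT => z.
  apply: (@continuousD _ _ _ (fun z => u z.1 z.2)); first exact: jet_continuous jet _.
  apply: continuousM; first exact: cst_continuous.
  by apply: continuousB; [exact: cst_continuous|exact: cvg_snd].
have [xc sT] : (forall i, 0 <= x 0 i <= 1) /\ t0 <= s <= T.
  move: zA; rewrite inE => -[/= xc sT]; split.
    by move=> i; have := xc i; rewrite /= in_itv.
  by move: sT; rewrite in_itv.
have {}zmin (y : 'rV[R]_n) t : (forall i, 0 <= y 0 i <= 1) -> t0 <= t <= T ->
    u x s + C * (T - s) <= u y t + C * (T - t).
  by move=> yc tT; exact: (zmin (y, t) (inA _ _ yc tT)).
have /andP[t0s] := sT; rewrite le_eqVlt => /predU1P[sE|sT'].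
  have := zmin x0 t0 x0c; rewrite lexx (ltW t0T) => /(_ isT).
  by have := uM x xc; rewrite sE; lra.
have s0 : 0 < s by exact: lt_le_trans t0s.
have s0T : 0 < s < T by rewrite s0.
(* The minimum may be attained at [s = t0], the lower end of the slab, so only forward increments
   are compared. They give [ut >= C], which with [u1 = 0] and [u2 >= 0] contradicts [pde] since
   [C > C0]. *)
have ts : 0 <= ut x s - C.
  have ds := jet_derive_t jet x s.
  have dg : is_derive s 1 (fun t => u x t + C * (T - t)) (ut x s - C).
    apply: is_derive_eq; by rewrite /GRing.scale /=; ring.
  apply: (is_derive_right_min dg (_ : 0 < T - s)); first by rewrite subr_gt0.
  move=> h /andP[h0 hT]; apply: zmin => //.
  by rewrite (le_trans t0s) ?lerDl ?(ltW h0)//=; lra.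
have sp i : u1 i x s = 0 /\ 0 <= u2 i x s.
  pose g h := u (h *: unitv i + x) s; pose g1 h := u1 i (h *: unitv i + x) s.
  have [||h hh|g10 l0] := @second_derivative_min R g g1 (u2 i x s).
  - move=> h; apply: is_derive_line (jet_derive_1 jet i (h *: unitv i + x) s) => k.
    have -> : k%:A = k :> R by rewrite /GRing.scale /= mulr1.
    by rewrite /g scalerDl addrA.
  - apply: is_derive_line (jet_derive_2 jet i x s) => k.
    have -> : k%:A = k :> R by rewrite /GRing.scale /= mulr1.
    by rewrite /g1 addr0.
  - rewrite /g scale0r add0r; apply: (cube_min_periodic (f := u ^~ s)) => //.
      by move=> y; exact: pu.
    by move=> y yc; have := zmin y s yc sT; lra.
  by move: g10; rewrite /g1 scale0r add0r.
have := pde x s s0T (fun i => (sp i).1).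
have : 0 <= \sum_i u2 i x s by apply: sumr_ge0 => i _; exact: (sp i).2.
lra.
Qed.

End minimum_principle.

(** * Solutions of the mean field game *)

Section jets.
Context {R : realType} {n : nat}.

Lemma smooth_jet (F : 'rV[R]_n * R -> R) : smooth F ->
  parabolic_jet (fun x t => F (x, t)) (fun x t => 'D_(0, 1) F (x, t))
    (fun i x t => 'D_(unitv i, 0) F (x, t))
    (fun i x t => 'D_(unitv i, 0) ('D_(unitv i, 0) F) (x, t)).
Proof.
move=> sF; have /= [cF dF] := sF 2%N.
have E (G : 'rV[R]_n * R -> R) : (fun z : 'rV[R]_n * R => G (z.1, z.2)) = G.
  by apply/funext => -[].
split.
- by rewrite (E F).
- by rewrite (E ('D_(0, 1) F)); have [_ []] := dF (0, 1).
- by move=> i; rewrite (E ('D_(unitv i, 0) F)); have [_ []] := dF (unitv i, 0).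
- move=> i; rewrite (E ('D_(unitv i, 0) ('D_(unitv i, 0) F))).
  by have [_ [_ d2]] := dF (unitv i, 0); have [_] := d2 (unitv i, 0).
- move=> x t; have [d _] := dF (0, 1); apply: is_derive_line (derivableP (d (x, t))) => h.
  by congr F; congr pair; rewrite /= scaler0 add0r.
- move=> i x t; have [d _] := dF (unitv i, 0); apply: is_derive_line (derivableP (d (x, t))) => h.
  by congr F; congr pair; rewrite /= scaler0 add0r.
move=> i x t; have [_ [_ d2]] := dF (unitv i, 0); have [d _] := d2 (unitv i, 0).
apply: is_derive_line (derivableP (d (x, t))) => h.
suff -> : h *: (unitv i, 0) + (x, t) = (h *: unitv i + x, t) by [].
by congr pair; rewrite /= scaler0 add0r.
Qed.

(** Used to identify the time derivative of [u] with that of its smooth extension: the two are only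
    known to agree on [0, T], which is enough at interior times. *)
Lemma derive1_eq_oo (f g : R -> R) (l t T : R) : 0 < t < T ->
  (forall s, 0 < s < T -> f s = g s) -> is_derive t 1 g l -> derive1 f t = l.
Proof.
move=> /andP[t0 tT] fg [_ <-]; rewrite derive1E.
apply: near_eq_derive.
near=> s; apply: fg; apply/andP; split; near: s; [exact: lt_nbhsr|exact: lt_nbhsl].
Unshelve. all: by end_near. Qed.

Lemma parabolic_jet_addc (v vt : 'rV[R]_n -> R -> R) v1 v2 (c : R) :
  parabolic_jet v vt v1 v2 -> parabolic_jet (fun x t => v x t + c) vt v1 v2.
Proof.
move=> [cv cvt cv1 cv2 dt d1 d2]; split => //.
- by move=> z; apply: continuousD; [exact: cv|exact: cst_continuous].
- move=> x t; have := is_deriveD (dt x t) (is_derive_cst c t 1).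
  by rewrite addr0.
- move=> i x t; have := is_deriveD (d1 i x t) (is_derive_cst c x (unitv i)).
  by rewrite addr0.
Qed.

Lemma is_derive_unique (V W : normedModType R) (f : V -> W) x v l l' :
  is_derive x v f l -> is_derive x v f l' -> l = l'.
Proof. by move=> [_ <-] [_ <-]. Qed.

Lemma is_derive_periodic (f f' : 'rV[R]_n -> R) (e v x : 'rV[R]_n) :
  (forall x, is_derive x v f (f' x)) -> (forall x, f (x + e) = f x) ->
  f' (x + e) = f' x.
Proof.
move=> df fe; apply: is_derive_unique (df x).
by apply: is_derive_line (df (x + e)) => h; rewrite addrA fe.
Qed.

Lemma continuous_rowP {T : topologicalType} (g : 'I_n -> T -> R) :
  (forall i, continuous (g i)) -> continuous (fun z => \row_i g i z).
Proof.
move=> cg z; apply/cvgrPdist_le => e e0.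
have : \forall y \near z, forall i, `|g i z - g i y| <= e.
  by apply: filter_forall => i; have /cvgrPdist_le/(_ e e0) := cg i z.
apply: filterS => y ye; apply: row_norm_le => [|i]; first exact: ltW.
by rewrite !mxE.
Qed.

End jets.

Section infinity_norm.
Local Open Scope ereal_scope.

Lemma Lnorm_pinfty_le d (S : measurableType d) (R : realType)
    (mu : {measure set S -> \bar R}) (f : S -> \bar R) (y : \bar R) :
  0 <= y -> (forall x, `|f x| <= y) -> 'N[mu]_+oo[f] <= y.
Proof.
move=> y0 fy; rewrite unlock; case: ifP => // _.
by apply/ess_supP; apply: nearW => x; exact: fy.
Qed.

Lemma mixed_norm_pinfty_le (R : realType) (n : nat) (T : R)
    (f : 'rV[R]_n -> R -> R) (y : \bar R) : 0 <= y ->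
  (forall (x : 'rV[R]_n) t, (forall i, 0%R <= x ord0 i < 1)%R -> (0 < t < T)%R ->
     (`|f x t|)%:E <= y) ->
  mixed_norm T +oo +oo f <= y.
Proof.
move=> y0 fy; apply: Lnorm_pinfty_le => // t; rewrite patchE; case: ifPn => [|_].
  rewrite inE /= in_itv /= => tT; rewrite gee0_abs ?Lnorm_ge0//.
  apply: Lnorm_pinfty_le => // x; rewrite patchE; case: ifPn => [|_].
    by rewrite inE => xc; exact: fy.
  by rewrite abse0.
by rewrite abse0.
Qed.

End infinity_norm.

Section regularized_coupling.
Context {R : realType} {d : nat}.

Lemma g_reg_ge0 (T : R) H (g : R -> R) (u0 m0 : 'rV[R]_d -> R) eta eps u m x t :
  (forall s, 0 <= s -> 0 <= g s) -> mollifying_kernel eta -> 0 < eps ->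
  mfg_solution T H g u0 m0 eta eps u m -> 0 <= t <= T ->
  0 <= g_reg g eta eps m x t.
Proof.
move=> g0 keta eps0 sol tT; apply: Rintegral_ge0 => y _; apply: mulr_ge0.
  by rewrite /rescale mulr_ge0 ?kernel_ge0// invr_ge0 exprn_ge0// ltW.
by apply: g0; exact: sol_domain sol _ _ tT.
Qed.

Lemma hamiltonian_bounded0 H (g : R -> R) (u0 m0 : 'rV[R]_d -> R) :
  standing_assumptions H g u0 m0 -> exists C : R, forall x, H x 0 <= C.
Proof.
move=> hyp; have [gamma [C [/andP[g1 _] HC]]] := sa_growth hyp.
exists C => x; apply: le_trans (HC x 0) _.
have -> : enorm (0 : 'rV[R]_d) = 0.
  rewrite /enorm /dot big1 ?sqrtr0// => i _; by rewrite mxE mul0r.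
rewrite powR0 ?mulr0 ?add0r// gt_eqF// (lt_trans _ g1)// ltr_pwDl// invr_ge0//.
Qed.

End regularized_coupling.

Theorem lemma1p1 (R : realType) (d : nat) (T : R)
    (H : 'rV[R]_d -> 'rV[R]_d -> R) (g : R -> R) (u0 m0 : 'rV[R]_d -> R)
    (a b : R)
    (hT : 0 < T)
    (hyp : standing_assumptions H g u0 m0)
    (ha : 1 < a) (hb : 1 < b)
    (hab : d%:R / 2 < b * (a - 1) / a) :
  exists2 C : R, 0 < C &
    forall (eta : 'rV[R]_d -> R) (eps : R) (u m : 'rV[R]_d -> R -> R),
      mollifying_kernel eta -> 0 < eps ->
      mfg_solution T H g u0 m0 eta eps u m ->
      (mixed_norm T +oo +oo u
        <= C%:E + C%:E * mixed_norm T a%:E b%:E (g_reg g eta eps m))%E.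
Proof.
have [C1 [C2 [C10 C20 ub]]] := @subsolution_bound R d T a b hT ha hb hab.
have [C0 HC0] := hamiltonian_bounded0 hyp.
have ham := sa_hamiltonian hyp.
have H1 := ham_ge1 ham.
have cH : continuous (fun z : 'rV[R]_d * 'rV[R]_d => H z.1 z.2) := ham_smooth ham 0%N.
have [u0p u0s] := sa_u0 hyp.
have cu0 : continuous (fun z : 'rV[R]_d * R => u0 z.1).
  by move=> z; apply: continuous_comp; [exact: cvg_fst|exact: (u0s 0%N)].
have [M0 u0M] := continuous_cube_bounded 0 0 (K := fun x _ => u0 x) cu0.
have {}u0M (x : 'rV[R]_d) : (forall i, 0 <= x 0 i <= 1) -> `|u0 x| <= M0.
  by move=> xc; apply: (u0M x 0 xc); rewrite lexx.
have M00 : 0 <= M0 by apply: le_trans (u0M 0 _) => // i; rewrite mxE lexx ler01.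
have C01 : 1 <= C0 by exact: le_trans (H1 0 0) (HC0 0).
(* The slope [C0 + 1] is a choice of constant strictly above [C0], as [minimum_principle] demands;
   over a time at most [T] it lowers the terminal bound [- M0] to [- M]. *)
pose M := M0 + (C0 + 1) * T.
have M1 : 0 <= M by rewrite addr_ge0// mulr_ge0 ?(ltW hT)//; lra.
(* [C] dominates the lower bound [M], the constant term [C1 * (M0 + M)] of the upper bound and the
   coefficient [C2] of the norm; the added 1 makes it positive. *)
pose C := M + C1 * (M0 + M) + C2 + 1.
have C1M : 0 <= C1 * (M0 + M) by rewrite mulr_ge0 ?(ltW C10)// addr_ge0.
have C_gt0 : 0 < C by rewrite /C; lra.
exists C => // eta eps u m keta eps0 sol.
have N0 : (0 <= mixed_norm T a%:E b%:E (g_reg g eta eps m))%E by exact: Lnorm_ge0.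
set N := mixed_norm T a%:E b%:E (g_reg g eta eps m).
have [[F sF Fu] up] := sol_u_smooth sol.
have jet := smooth_jet sF.
set v := (fun x t => F (x, t)) in jet.
set vt := (fun x t => 'D_(0, 1) F (x, t)) in jet.
set v1 := (fun i x t => 'D_(unitv i, 0) F (x, t)) in jet.
set v2 := (fun i x t => _) in jet.
have vu t : 0 <= t <= T -> v ^~ t = u ^~ t.
  by move=> tT; apply/funext => x; exact: Fu.
have pv i (x : 'rV[R]_d) t : 0 < t < T -> v (x + unitv i) t = v x t.
  move=> /andP[t0 tT]; have tc : 0 <= t <= T by rewrite !ltW.
  by rewrite /v !Fu//; exact: up.
have pv1 j i (x : 'rV[R]_d) t : 0 < t < T -> v1 j (x + unitv i) t = v1 j x t.
  move=> tT; apply: (is_derive_periodic (f' := v1 j ^~ t)) => y.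
    exact: jet_derive_1 jet j y t.
  exact: pv.
(* The right-hand side is read off from the equation rather than from [g_reg]: this [f] is jointly
   continuous at all times and coincides with [g_reg] on ]0, T[, which is all that [mixed_norm]
   sees. *)
pose f (x : 'rV[R]_d) t : R := H x (\row_i v1 i x t) - vt x t - \sum_i v2 i x t.
have fg (x : 'rV[R]_d) t : 0 < t < T -> f x t = g_reg g eta eps m x t.
  move=> tT; have /andP[t0 tT'] := tT; have tc : 0 <= t <= T by rewrite !ltW.
  have := sol_hamilton_jacobi sol x tT.
  have pE i : partial i (u ^~ t) = v1 i ^~ t.
    apply/funext => y; rewrite /partial -(vu t tc).
    by apply: derive_val; exact: jet_derive_1 jet i y t.
  have gE : grad (u ^~ t) = fun x => \row_i v1 i x t.
    by apply/funext => y; apply/rowP => i; rewrite !mxE pE.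
  have lE : laplacian (u ^~ t) x = \sum_i v2 i x t.
    rewrite /laplacian; apply: eq_bigr => i _; rewrite pE.
    by apply: derive_val; exact: jet_derive_2 jet i x t.
  have tE : derive1 (u x) t = vt x t.
    apply: (derive1_eq_oo tT) (jet_derive_t jet x t) => s /andP[s0 sT].
    by apply/esym/Fu; rewrite (ltW s0) (ltW sT).
  by rewrite gE lE tE /f; lra.
have cf : continuous (fun z : 'rV[R]_d * R => f z.1 z.2).
  move=> z; apply: (@continuousB _ _ _ (fun z : 'rV[R]_d * R => H z.1 (\row_i v1 i z.1 z.2) - vt z.1 z.2)).
    apply: (@continuousB _ _ _ (fun z : 'rV[R]_d * R => H z.1 (\row_i v1 i z.1 z.2))).
      apply: (@continuous_comp _ _ _
        (fun z : 'rV[R]_d * R => (z.1, \row_i v1 i z.1 z.2)) (fun z => H z.1 z.2)).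
        apply: continuous_pair_at; first exact: cvg_fst.
        by apply: (continuous_rowP (g := fun i z => v1 i z.1 z.2)) => i; exact: jet_continuous_1 jet i.
      exact: cH.
    exact: jet_continuous_t jet z.
  by apply: continuous_sum_at => i; exact: jet_continuous_2 jet i z.
have NE : mixed_norm T a%:E b%:E f = N.
  rewrite /N /mixed_norm; congr (Lnorm _ _ _); apply/funext => t; rewrite !patchE.
  case: ifPn => //; rewrite inE /= in_itv /= => tT.
  by congr torus_norm; apply/funext => x; exact: fg.
have lb (x : 'rV[R]_d) t : (forall i, 0 <= x 0 i <= 1) -> 0 < t < T -> - M <= v x t.
  move=> xc tT; have C0C : C0 < C0 + 1 by lra.
  have := minimum_principle (M := - M0) jet C0C pv.
  move=> H2; apply: le_trans (H2 _ _ x t xc tT).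
  - rewrite /M; have /andP[t0 _] := tT.
    have : 0 <= (C0 + 1) * t by rewrite mulr_ge0 ?(ltW t0)//; lra.
    lra.
  - move=> y s sT Dy; have := fg y s sT; rewrite /f.
    rewrite (_ : \row_i _ = 0); last by apply/rowP => i; rewrite !mxE Dy.
    have g0 : 0 <= g_reg g eta eps m y s.
      apply: (g_reg_ge0 y (sa_g hyp).1 keta eps0 sol); have /andP[s0 sT'] := sT; by rewrite !ltW.
    by have := HC0 y; lra.
  move=> y yc; rewrite /v Fu ?lexx ?(ltW hT)// (sol_terminal sol).
  by have := u0M y yc; rewrite ler_norml => /andP[].
apply: mixed_norm_pinfty_le => [|x t xc tT].
  by rewrite adde_ge0 ?mule_ge0 ?lee_fin ?(ltW C_gt0).
have /andP[t0 tT'] := tT; have tc : 0 <= t <= T by rewrite !ltW.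
have cl (y : 'rV[R]_d) : (forall i, 0 <= y 0 i < 1) -> (forall i, 0 <= y 0 i <= 1).
  by move=> yc i; have /andP[-> /ltW] := yc i.
have jM := parabolic_jet_addc M jet.
have := ub _ _ _ _ f (M0 + M) x t jM cf _ _ _ _ _ _ xc tT.
rewrite NE => U.
have {}U : ((v x t + M)%:E <= (C1 * (M0 + M))%:E + C2%:E * N)%E.
  apply: U.
  - by move=> i y s sT; rewrite pv.
  - by move=> i y s sT; rewrite pv1.
  - by move=> y s yc sT; have := lb y s (cl y yc) sT; lra.
  (* With this [f], the expression [vt + Lap v + f] is exactly [H], so the differential inequality
     is the bound [H >= 1]. *)
  - move=> y s sT; rewrite /f; have := H1 y (\row_i v1 i y s); lra.
  - move=> y yc; rewrite lerD2r /v Fu ?lexx ?(ltW hT)// (sol_terminal sol).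
    by apply: le_trans (ler_norm _) (u0M y (cl y yc)).
  - by rewrite addr_ge0.
have ux : u x t = v x t by rewrite /v Fu.
have lbx := lb x t (cl x xc) tT.
have [Noo|Nfin] := eqVneq N +oo%E.
  by rewrite Noo gt0_muley ?lte_fin// addey// leey.
have Nf : N \is a fin_num by rewrite ge0_fin_numE// ltey.
move: U; rewrite -(fineK Nf) -!EFinM -!EFinD !lee_fin => U.
have n0 : 0 <= fine N by exact: fine_ge0.
have C2n : 0 <= C2 * fine N by rewrite mulr_ge0// ltW.
have CC : C2 * fine N <= C * fine N by rewrite ler_wpM2r// /C; lra.
by rewrite ux ler_norml; apply/andP; split; rewrite /C; move: CC; rewrite /C; lra.
Qed.
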